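(* Let $n\geq -1$ be an integer, let $X$ be a paracompact space with $\dim(X)\leq n+1$, let $Y$ be a completely metrizable space, and let $\mathscr{S}\subset\mathscr{F}(Y)$ be an equi-$LC^n$ family such that each $S\in\mathscr{S}$ is $C^n$. Then each lower semi-continuous mapping $\Phi:X\to\mathscr{S}$ has a continuous selection, i.e. there is a continuous map $f:X\to Y$ with $f(x)\in\Phi(x)$ for all $x\in X$.
   Context: All spaces are Hausdorff topological spaces; $\dim$ is covering dimension. $\mathscr{F}(Y)$ is the collection of all nonempty closed subsets of $Y$. A mapping $\Phi$ from $X$ to the nonempty subsets of $Y$ is lower semi-continuous if $\{x\in X:\Phi(x)\cap U\neq\emptyset\}$ is open in $X$ for every open $U\subset Y$. For $n\geq -1$, a family $\mathscr{S}$ of nonempty subsets of $Y$ is equi-$LC^n$ if every neighbourhood $U$ of a point $y\in\bigcup\mathscr{S}$ contains a neighbourhood $V$ of $y$ such that for every $S\in\mathscr{S}$ and every $0\le k\leq n$, every continuous map $g:\mathbb{S}^k\to V\cap S$ of the $k$-sphere extends to a continuous map $h:\mathbb{B}^{k+1}\to U\cap S$ of the $(k+1)$-ball. By convention, equi-$LC^{-1}$ means only that the family consists of nonempty subsets. A nonempty space $S$ is $C^n$ if for every $0\le k\leq n$, every continuous map $\mathbb{S}^k\to S$ extends to a continuous map $\mathbb{B}^{k+1}\to S$; every nonempty $S$ is $C^{-1}$. *)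

(* Defs.v *)
From mathcomp Require Import all_boot all_order all_algebra.
From mathcomp Require Import all_classical all_reals topology normedtype.

Set Implicit Arguments.
Unset Strict Implicit.
Unset Printing Implicit Defensive.

Import Order.TTheory GRing.Theory Num.Theory.
Import numFieldNormedType.Exports.

Local Open Scope classical_set_scope.
Local Open Scope ring_scope.

Section covers.
Context {X : topologicalType}.
Implicit Types (UU VV : set (set X)).

Definition open_cover UU :=
  UU `<=` open /\ \bigcup_(U in UU) U = [set: X].

Definition refines VV UU :=
  forall V, VV V -> exists2 U, UU U & V `<=` U.

Definition locally_finite VV :=
  forall x : X, exists2 N, nbhs x N &
    finite_set [set V | VV V /\ V `&` N !=set0].

(* Each point lies in at most m + 1 members of VV (meaningful for m >= -1). *)
Definition order_le VV (m : int) :=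
  forall x : X, exists2 k : nat, k%:Z <= m + 1 &
    ([set V | VV V /\ V x] #<= `I_k)%card.

End covers.

(* The Hausdorff axiom is not included here; it is assumed separately. *)
Definition paracompact_space (X : topologicalType) :=
  forall UU : set (set X), open_cover UU ->
    exists VV : set (set X),
      [/\ open_cover VV, refines VV UU & locally_finite VV].

(* dim X <= m for the Cech-Lebesgue covering dimension, defined (as in
   Engelking's "Dimension Theory") through finite open covers. *)
Definition covering_dim_le (X : topologicalType) (m : int) :=
  forall UU : set (set X), finite_set UU -> open_cover UU ->
    exists VV : set (set X),
      [/\ finite_set VV, open_cover VV, refines VV UU & order_le VV m].

Section complete_metrizability.
Context {R : realType} {Y : topologicalType}.
Implicit Types (d : Y -> Y -> R).

Definition is_metric d :=
  [/\ forall x y, 0 <= d x y,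
      forall x y, d x y = 0 <-> x = y,
      forall x y, d x y = d y x
    & forall x y z, d x z <= d x y + d y z].

Definition metric_induces_topology d :=
  forall (y : Y) (A : set Y),
    nbhs y A <-> exists2 e : R, 0 < e & [set z | d y z < e] `<=` A.

Definition metric_cauchy d (u : nat -> Y) :=
  forall e : R, 0 < e ->
    exists N : nat, forall i j : nat,
      (N <= i)%N -> (N <= j)%N -> d (u i) (u j) < e.

Definition metric_complete d :=
  forall u : nat -> Y, metric_cauchy d u -> exists y : Y, u @ \oo --> y.

End complete_metrizability.

Definition completely_metrizable (R : realType) (Y : topologicalType) :=
  exists d : Y -> Y -> R,
    [/\ is_metric d, metric_induces_topology d & metric_complete d].

(* The norm of 'rV[R]_k is the sup norm, hence the explicit Euclidean
   equations; the topology of 'rV[R]_k is the usual (product) one. *)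
Definition unit_sphere (R : realType) (k : nat) : set 'rV[R]_k.+1 :=
  [set u | \sum_(i < k.+1) u ord0 i ^+ 2 = 1].

Definition unit_ball (R : realType) (k : nat) : set 'rV[R]_k :=
  [set u | \sum_(i < k) u ord0 i ^+ 2 <= 1].

Arguments unit_sphere : clear implicits.
Arguments unit_ball : clear implicits.

(* For all 0 <= k <= n, every continuous map from the k-sphere to A extends to
   a continuous map from the (k+1)-ball to B. Maps defined on the sphere or the
   ball are represented by total functions on the ambient space R^(k+1), whose
   values elsewhere are irrelevant. *)
Definition spheres_extend (R : realType) (Y : topologicalType) (n : int)
    (A B : set Y) :=
  forall k : nat, k%:Z <= n ->
  forall g : 'rV[R]_k.+1 -> Y,
    {within unit_sphere R k, continuous g} ->
    g @` unit_sphere R k `<=` A ->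
    exists h : 'rV[R]_k.+1 -> Y,
      [/\ {within unit_ball R k.+1, continuous h},
          h @` unit_ball R k.+1 `<=` B
        & forall u, unit_sphere R k u -> h u = g u].

Definition C_space (R : realType) (Y : topologicalType) (n : int)
    (S : set Y) :=
  S !=set0 /\ spheres_extend R n S S.

Definition equi_LC (R : realType) (Y : topologicalType) (n : int)
    (SS : set (set Y)) :=
  (forall S, SS S -> S !=set0) /\
  forall y : Y, (\bigcup_(S in SS) S) y ->
  forall U : set Y, nbhs y U ->
    exists V : set Y, [/\ nbhs y V, V `<=` U &
      forall S, SS S -> spheres_extend R n (V `&` S) (U `&` S)].

Definition nonempty_closed (Y : topologicalType) : set (set Y) :=
  [set S | S !=set0 /\ closed S].

Arguments nonempty_closed : clear implicits.

Definition lower_semicontinuous_map (X Y : topologicalType)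
    (Phi : X -> set Y) :=
  forall U : set Y, open U -> open [set x | Phi x `&` U !=set0].

Definition continuous_selection (X Y : topologicalType)
    (Phi : X -> set Y) (f : X -> Y) :=
  continuous f /\ forall x, Phi x (f x).

(* Main.v *)
Require Import Defs.
From mathcomp Require Import all_boot all_order all_algebra finmap.
From mathcomp Require Import all_classical all_reals topology normedtype.
From mathcomp Require Import realfun ring lra zify.

Set Implicit Arguments.
Unset Strict Implicit.
Unset Printing Implicit Defensive.

Import Order.TTheory GRing.Theory Num.Theory.
Import numFieldNormedType.Exports.

Local Open Scope classical_set_scope.
Local Open Scope ring_scope.

(** This is Michael's finite-dimensional selection theorem. Write N = n + 1.

    The combinatorial core is [chain_selection]. Suppose that Psi_0, ..., Psi_N
    map X to the subsets of some space, that maps of the k-sphere into Psi_k(x)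
    extend to the ball inside Psi_(k+1)(x), and that every Psi_k is lower
    locally constant: a compact subset of Psi_k(x) is contained in Psi_k(y) for
    all y near x. Then Psi_N has a continuous selection when X is paracompact
    and dim X <= N. Choose locally finite covers U_0, ..., U_N one after the
    other. With each vertex, a member of some U_j, comes a centre x. When U_i is
    about to be chosen, the map built so far on the simplices with vertices in
    U_0, ..., U_(i-1) is extended over the cone with vertex x of those
    simplices that have x as a common point; the extension takes place inside
    the sets Psi_k(x), one dimension after the other. Only finitely many
    compact images are involved, so lower local constancy provides a
    neighbourhood of x on which they remain admissible, and U_i refines the
    cover by these neighbourhoods. Dimension enters at the end: a common
    refinement of the covers splits into N + 1 families of disjoint sets
    ([ostrand_paracompact]), which gives barycentric coordinates with at most
    one vertex on each level.

    Thickenings of the values of a lower semi-continuous map are lower locally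
    constant, so one would like to apply this to them. A sphere close to a
    member S of the family has to be extended close to S. In a space where
    nearby points are joined by short segments, it suffices to approximate the
    sphere by a sphere in S, to fill the latter inside S, and to insert the
    segments ([ball_glue]). The approximation is itself a selection of the
    constant map S near the given sphere, so it is again an instance of
    [chain_selection], this time over the sphere ([approximation]); there the
    disjoint families come from shifted grids ([ostrand_compact]).

    Equi-local connectedness only gives sizes that depend on the point. They
    are made uniform over the family by 1-Lipschitz functions, called moduli
    below, and thickenings have the modulus as variable radius. As in Michael's
    proof, each approximate selection is then improved to a better one that is
    uniformly close to it ([next_selection]), and the limit is a selection
    because the values are complete ([metric_selection]). Finally Y has no
    segments, but Kuratowski's map embeds it into the space of real functions
    on Y, and all hypotheses concern the members of the family only, not the
    ambient space. *)

(** * Locally finite families and paracompact spaces *)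

Lemma near_finite (T : Type) (F : set_system T) (I : choiceType) (D : set I)
    (P : I -> T -> Prop) : Filter F -> finite_set D ->
  (forall i, D i -> \forall x \near F, P i x) ->
  \forall x \near F, forall i, D i -> P i x.
Proof.
move=> FF /finite_fsetP[E ->] EP.
have H := @filter_bigI _ _ E (fun i => [set y | P i y]) F FF EP.
by apply: filterS H => y Hy i iE; exact: Hy.
Qed.

Section locally_finite_families.
Context {X : topologicalType}.

Definition locally_finite_family (I : Type) (U : I -> set X) :=
  forall x : X, exists2 N : set X, nbhs x N & finite_set [set i | U i `&` N !=set0].

Lemma locally_finite_familyS (I : Type) (U V : I -> set X) :
  (forall i, V i `<=` U i) -> locally_finite_family U -> locally_finite_family V.
Proof.
move=> VU lfU x; have [N Nx fN] := lfU x; exists N => //.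
by apply: sub_finite_set fN => i [y [Vy Ny]]; exists y; split=> //; exact: VU.
Qed.

Lemma locally_finite_closure_bigcup (I : choiceType) (U : I -> set X) (D : set I) :
  locally_finite_family U ->
  closure (\bigcup_(i in D) U i) `<=` \bigcup_(i in D) closure (U i).
Proof.
move=> lfU x clx; have [N Nx fN] := lfU x; apply: contrapT => nx.
have: \forall y \near x, forall i, [set i | U i `&` N !=set0] i ->
    D i -> ~ U i y.
  apply: near_finite => // i _.
  have [cli|ncli] := pselect (closure (U i) x).
    by apply: nearW => y Di; exfalso; apply: nx; exists i.
  move: ncli; rewrite /closure /= => /existsNP[B] /not_implyP[Bx] UB.
  by apply: filterS Bx => y By _ Uy; apply: UB; exists y.
move=> /(filterI Nx) /clx[y [[i Di Uy] [Ny Hy]]].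
by apply: (Hy i) => //; exists y.
Qed.

Lemma locally_finite_closure (I : choiceType) (U : I -> set X) :
  locally_finite_family U -> locally_finite_family (fun i => closure (U i)).
Proof.
move=> lfU y; have [N Ny fN] := lfU y; exists N°; first exact: nbhs_interior.
apply: sub_finite_set fN => i [z [clz Nz]].
by have [w [Uw Nw]] := clz _ Nz; exists w.
Qed.

End locally_finite_families.

Section paracompact.
Context {X : topologicalType}.
Hypotheses (hX : hausdorff_space X) (pX : paracompact_space X).

(** Collecting the members of a refinement according to the set of the cover
    that contains them makes the refinement precise: it is indexed like the
    cover. Below this allows covers, and hence vertices, to be indexed by the
    points of the space. *)
Lemma paracompact_cover (I : choiceType) (O : I -> set X) :
  (forall i, open (O i)) -> (forall x, exists i, O i x) ->
  exists U : I -> set X, [/\ forall i, open (U i), forall x, exists i, U i x,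
    forall i, U i `<=` O i & locally_finite_family U].
Proof.
move=> oO cO.
have [[x0 _]|noX] := pselect (exists x : X, True); last first.
  have F (x : X) : False by apply: noX; exists x.
  by exists O; split=> [//|//|i x|x]; case: (F x).
have [|V [[oV cV] rV lfV]] := pX (UU := range O).
  split; first by move=> _ [i _ <-].
  by apply/seteqP; split=> // x _; have [i Oi] := cO x; exists (O i).
have [i0 _] := cO x0.
have /choice[a aP] : forall W : set X, exists i : I, V W -> W `<=` O i.
  move=> W; have [VW|nVW] := pselect (V W); last by exists i0.
  by have [_ [i _ <-] WO] := rV _ VW; exists i.
exists (fun i => \bigcup_(W in [set W | V W /\ a W = i]) W); split.
- by move=> i; apply: bigcup_open => W [VW _]; exact: oV.
- move=> x; have : setT x by [].
  by rewrite -cV => -[W VW Wx]; exists (a W); exists W.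
- by move=> i x [W [VW <-] Wx]; exact: aP Wx.
- move=> x; have [N Nx fN] := lfV x; exists N => //.
  apply: sub_finite_set (finite_image a fN) => i [y [[W [VW aW] Wy] Ny]].
  by exists W => //; split=> //; exists y.
Qed.

(** The points of C have open neighbourhoods whose closures avoid x; by local
    finiteness, so does the closure of the union of a refinement. *)
Lemma paracompact_regular (x : X) (C : set X) : closed C -> ~ C x ->
  exists2 W, open W & C `<=` W /\ ~ closure W x.
Proof.
move=> cC nCx.
have /choice[V VP] : forall y : X, exists V : set X, open V /\ V y /\
    (C y -> ~ closure V x) /\ (~ C y -> V = ~` C).
  move=> y; have [Cy|nCy] := pselect (C y); last first.
    by exists (~` C); split; [exact: closed_openC|split].
  have yx : y != x by apply/eqP => yx; apply: nCx; rewrite -yx.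
  move: hX; rewrite open_hausdorff => /(_ _ _ yx)[[A B] /= [yA xB] [oA oB AB]].
  exists A; split=> //; split; first by rewrite inE in yA.
  split=> // _ /(_ B); case; first by apply: open_nbhs_nbhs; rewrite inE in xB.
  by move=> z ABz; move: AB => /eqP; rewrite -subset0 => /(_ z); apply.
have [||U [oU cU UV lfU]] := @paracompact_cover X V.
- by move=> y; have [] := VP y.
- by move=> y; exists y; have [_ []] := VP y.
exists (\bigcup_(y in C) U y); first by apply: bigcup_open.
split.
  move=> y Cy; have [z Uz] := cU y; exists z => //; apply: contrapT => nCz.
  by have := UV _ _ Uz; have [_ [_ [_ -> //]]] := VP z.
move=> /(locally_finite_closure_bigcup lfU)[y Cy]; have [_ [_ [/(_ Cy) H _]]] := VP y.
by move=> /(closureS (UV y)).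
Qed.

(** Regularity gives a cover by open sets whose closures refine the given
    cover; a precise refinement of it keeps this property because the closure
    of a locally finite union is the union of the closures. *)
Lemma paracompact_shrink (I : choiceType) (O : I -> set X) :
  (forall i, open (O i)) -> (forall x, exists i, O i x) ->
  exists U : I -> set X, [/\ forall i, open (U i), forall x, exists i, U i x,
    forall i, closure (U i) `<=` O i & locally_finite_family U].
Proof.
move=> oO cO; have [a aP] := choice cO.
have /choice[V VP] : forall x : X, exists V : set X,
    [/\ open V, V x & closure V `<=` O (a x)].
  move=> x; have [||W oW [CW ncl]] := @paracompact_regular x (~` O (a x)).
  - exact: open_closedC.
  - by apply; exact: aP.
  exists (~` closure W); split=> //; first exact/closed_openC/closed_closure.
  move=> y cly; apply: contrapT => nOy.
  have Wy : nbhs y W by apply: open_nbhs_nbhs; split=> //; exact: CW.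
  by have [z [ncz Wz]] := cly W Wy; exact: ncz (subset_closure Wz).
have [||U [oU cU UV lfU]] := @paracompact_cover X V.
- by move=> y; have [] := VP y.
- by move=> y; exists y; have [] := VP y.
exists (fun i => \bigcup_(x in [set x | a x = i]) U x); split.
- by move=> i; exact: bigcup_open.
- by move=> x; have [y Uy] := cU x; exists (a y), y.
- move=> i x /(locally_finite_closure_bigcup lfU)[y <- cly]; have [_ _] := VP y.
  by apply; exact: closureS cly.
- move=> x; have [N Nx fN] := lfU x; exists N => //.
  apply: sub_finite_set (finite_image a fN) => i [y [[z <- Uz] Ny]].
  by exists z => //; exists y.
Qed.

Lemma paracompact_normal : normal_space X.
Proof.
move=> A cA B /set_nbhsP[C [oC AC CB]].
have [||U [oU cU clU _]] :=
    @paracompact_shrink bool (fun b => if b then C else ~` A).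
- by case=> //; exact: closed_openC.
- move=> x; have [Ax|nAx] := pselect (A x); first by exists true; exact: AC.
  by exists false.
exists (U true); last by move=> x /clU/CB.
apply/set_nbhsP; exists (U true); split=> // x Ax.
have [[//|Ux]] := cU x.
by have /clU/= := subset_closure Ux.
Qed.

(** A partition of unity up to normalization. Shrinking twice leaves room for a
    Urysohn function for each index. *)
Lemma bump_functions (R : realType) (I : choiceType) (O : I -> set X) :
  (forall i, open (O i)) -> (forall x, exists i, O i x) ->
  exists q : I -> X -> R, [/\ forall i, continuous (q i),
    forall i x, 0 <= q i x, forall i x, 0 < q i x -> O i x,
    forall x, exists i, 0 < q i x & locally_finite_family (fun i => [set x | 0 < q i x])].
Proof.
move=> oO cO; have [U [oU cU UO lfU]] := paracompact_shrink oO cO.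
have [V [oV cV VU lfV]] := paracompact_shrink oU cU.
pose q i : X -> R := Urysohn (~` U i) (closure (V i)).
have sepq i : @uniform_separator X (~` U i) (closure (V i)).
  apply: normal_uniform_separator; first exact: paracompact_normal.
  - exact: open_closedC.
  - exact: closed_closure.
  - by apply/disjoints_subset => x nUx /VU.
have q0 i x : ~ U i x -> q i x = 0.
  by move=> nUx; apply: (Urysohn_sub0 (sepq i)); exists x.
have qge0 i x : 0 <= q i x.
  have : range (q i) (q i x) by exists x.
  by move=> /Urysohn_range; rewrite /= in_itv /= => /andP[].
have qU i x : 0 < q i x -> U i x.
  by move=> qx; apply: contrapT => /q0 q0x; rewrite q0x ltxx in qx.
exists q; split=> //.
- by move=> i; exact: Urysohn_continuous.
- by move=> i x /qU Ux; apply: UO; exact: subset_closure.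
- move=> x; have [i Vx] := cV x; exists i.
  rewrite [q i x](_ : _ = 1) ?ltr01//.
  by apply: (Urysohn_sub1 (sepq i)); exists x => //; exact: subset_closure.
- by apply: locally_finite_familyS lfU => i x; exact: qU.
Qed.

End paracompact.

(** * Covering dimension and disjoint families *)

Section cells.
Context {X : topologicalType} {R : realType} {I : choiceType}.
Variable q : I -> X -> R.
Hypothesis cq : forall i, continuous (q i).
Hypotheses (lfq : locally_finite_family (fun i => [set x | 0 < q i x])).
Hypothesis covq : forall x, exists i, 0 < q i x.

(** The indices in F have the largest values of q at x. For a partition of unity
    the cells are the preimages of the open stars of the vertices of the first
    barycentric subdivision of the nerve: two distinct sets F of the same
    cardinality have disjoint cells. *)
Definition cell (F : {fset I}) (x : X) :=
  F != fset0 /\ forall i, i \in F ->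
    0 < q i x /\ forall j, j \notin F -> q j x < q i x.

Lemma cell_near (F : {fset I}) x : cell F x -> \forall y \near x, cell F y.
Proof.
move=> [F0 Fx]; have [N Nx fN] := lfq x.
have qgt i : q i y @[y --> x] --> q i x by exact: cq.
have H : \forall y \near x, forall i, [set` F] i -> 0 < q i y /\
   forall j, [set i | [set x | 0 < q i x] `&` N !=set0] j ->
     j \notin F -> q j y < q i y.
  apply: near_finite; first exact: finite_fset.
  move=> i /= iF; have [qi qj] := Fx _ iF; apply: filterI; first exact: cvgr_gt (qgt i) _ qi.
  apply: near_finite => // j _.
  have [jF|jF] := boolP (j \in F); first exact: nearW.
  have := qj j jF; rewrite -subr_gt0 => qji.
  have : (fun y => q i y - q j y) y @[y --> x] --> q i x - q j x.
    by apply: cvgB; exact: cq.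
  move=> /cvgr_gt -/(_ _ qji); apply: filterS => y + _.
  by rewrite subr_gt0.
apply: filterS2 Nx H => y Ny H; split=> // i iF.
have [qi qj] := H i iF; split=> // j jF.
have [qjy|qjy] := ltP 0 (q j y); last exact: le_lt_trans qi.
by apply: qj => //; exists y.
Qed.

Lemma cell_uniq (F G : {fset I}) x :
  cell F x -> cell G x -> #|` F| = #|` G| -> F = G.
Proof.
move=> [_ Fx] [_ Gx] FG.
have sub (A B : {fset I}) : #|` A| = #|` B| -> ~ (A `<=` B)%fset ->
    exists2 j, j \in B & j \notin A.
  move=> AB nAB; apply: contrapT => nj; apply: nAB.
  have BA : (B `<=` A)%fset.
    apply/fsubsetP => j jB; apply: contrapT => /negP jA; apply: nj.
    by exists j.
  have : B == A by rewrite eqEfcard BA AB leqnn.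
  by move=> /eqP ->.
apply/eqP; rewrite eqEfcard FG leqnn andbT; apply: contrapT => nFG.
have [j jG jF] := sub _ _ FG nFG.
have [i iF iG] : exists2 i, i \in F & i \notin G.
  by move/negP: nFG => /fsubsetPn[i]; exists i.
have [_ /(_ _ jF)] := Fx _ iF; have [_ /(_ _ iG)] := Gx _ jG.
by move=> /lt_trans/[apply]; rewrite ltxx.
Qed.

(** The indices where the maximum of q at x is attained form such a set. *)
Lemma cell_ex x : exists F, cell F x.
Proof.
have [N /nbhs_singleton Nx fN] := lfq x.
have /finite_fsetP[E Ex] : finite_set [set i | 0 < q i x].
  by apply: sub_finite_set fN => i qi; exists x.
have EP i : i \in E <-> 0 < q i x.
  by have -> : (0 < q i x) = [set` E] i :> Prop by rewrite -Ex.
have [i0 /EP i0E] := covq x.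
pose i1 := [arg max_(j > [` i0E]%fset) q (val j) x]%O.
have maxi1 j : j \in E -> q j x <= q (val i1) x.
  move=> jE; rewrite /i1; case: arg_maxP => // i _ H.
  exact: (H [` jE]%fset).
exists [fset j in E | q j x == q (val i1) x]%fset; split.
  by apply/fset0Pn; exists (val i1); rewrite !inE/= (valP i1) eqxx.
move=> i; rewrite !inE /= => /andP[iE /eqP qi]; split; first exact/EP.
move=> j; rewrite !inE /= negb_and => /orP[jE|qj].
  have : ~ 0 < q j x by move=> /EP; exact/negP.
  move=> /negP; rewrite -leNgt => /le_lt_trans; apply; exact/EP.
have [jE|jE] := boolP (j \in E).
  by rewrite qi lt_neqAle qj maxi1.
have : ~ 0 < q j x by move=> /EP; exact/negP.
move=> /negP; rewrite -leNgt => /le_lt_trans; apply; exact/EP.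
Qed.

(** The cells of the sets with n + 1 indices form the disjoint family A n. The
    label l n x is an index of the cell that contains x; being chosen from the
    cell alone, it is locally constant on A n. *)
Lemma cell_labels : exists (A : nat -> set X) (l : nat -> X -> I),
  [/\ forall x, exists n, A n x,
      forall n x, A n x -> 0 < q (l n x) x /\
        \forall y \near x, A n y /\ l n y = l n x,
      locally_finite_family A &
      forall n x, A n x -> exists F : {fset I}, #|` F| = n.+1 /\
        forall i, i \in F -> 0 < q i x].
Proof.
have [i0 _] := choice covq.
pose A n := [set x | exists F, #|` F| = n.+1 /\ cell F x].
have /choice[L LP] : forall nx : nat * X, exists F : {fset I},
    A nx.1 nx.2 -> #|` F| = nx.1.+1 /\ cell F nx.2.
  move=> [n x]; have [[F FP]|nA] := pselect (A n x); first by exists F.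
  by exists fset0.
have Lnear n x : A n x -> \forall y \near x, A n y /\ L (n, y) = L (n, x).
  move=> Anx; have [/= Fn cF] := LP (n, x) Anx.
  have := cell_near cF; apply: filterS => y cFy.
  have Any : A n y by exists (L (n, x)).
  split=> //; have [/= Fny cFy'] := LP (n, y) Any.
  by apply: cell_uniq cFy' cFy _; rewrite Fny.
have L0 n x : A n x -> (size (enum_fset (L (n, x))) > 0)%N.
  by move=> Anx; have [/= -> _] := LP (n, x) Anx.
exists A, (fun n x => nth (i0 x) (enum_fset (L (n, x))) 0); split.
- move=> x; have [F cF] := cell_ex x; exists #|` F|.-1, F; split=> //.
  by case: cF; rewrite -cardfs_gt0 => ? _; rewrite prednK.
- move=> n x Anx; split.
    have [/= _ [_ H]] := LP (n, x) Anx.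
    by have [] := H _ (mem_nth (i0 x) (L0 _ _ Anx)).
  have := Lnear n x Anx; apply: filterS => y [Any Lyx]; split=> //.
  by rewrite Lyx; apply: set_nth_default; exact: L0.
- move=> x; have [N Nx fN] := lfq x; exists N => //.
  have /finite_fsetP[E NE] := fN.
  apply: (@sub_finite_set _ _ `I_#|` E|); last exact: finite_II.
  move=> n [y [[F [Fn [_ cF]]] Ny]] /=; rewrite -Fn.
  apply: fsubset_leq_card; apply/fsubsetP => i iF.
  have : [set` E] i; last by [].
  by rewrite -NE; exists y; split=> //; have [] := cF _ iF.
- move=> n x [F [Fn [_ cF]]]; exists F; split=> // i iF.
  by have [] := cF _ iF.
Qed.

End cells.

(** The conclusion of Ostrand's theorem. A disjoint open family that refines the
    cover O is given by its union A n and by a locally constant label c n on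
    A n, the index of a set of the cover that contains the point. *)
Definition ostrand (N : nat) (X : topologicalType) :=
  forall O : X -> set X, (forall x, open (O x)) -> (forall x, O x x) ->
  exists (A : nat -> set X) (c : nat -> X -> X),
    (forall x, exists2 n, (n <= N)%N & A n x) /\
    forall n x, A n x -> O (c n x) x /\
      \forall y \near x, A n y /\ c n y = c n x.

Section shrink_countable.
Context {X : topologicalType} (N : nat).
Hypothesis dX : covering_dim_le X N%:Z.

Definition multiplicity_le (I : choiceType) (W : I -> set X) :=
  forall (F : {fset I}) x, (forall i, i \in F -> W i x) -> (#|` F| <= N.+1)%N.

(** A finite refinement of small order becomes a shrinking of the same order
    when its members are collected according to the sets that contain them. *)
Lemma finite_shrink (m : nat) (U : nat -> set X) :
  (forall i, (i < m)%N -> open (U i)) ->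
  (forall x, exists2 i, (i < m)%N & U i x) ->
  exists W : nat -> set X, [/\ forall i, open (W i),
    forall x, exists2 i, (i < m)%N & W i x, forall i, W i `<=` U i, multiplicity_le W &
    forall i, (m <= i)%N -> W i = set0].
Proof.
move=> oU cU.
have [| |V [fV [oV cV] rV ordV]] := dX (UU := U @` `I_m).
- exact/finite_image/finite_II.
- split; first by move=> _ [i im <-]; exact: oU.
  apply/seteqP; split=> // x _; have [i im Ui] := cU x.
  by exists (U i) => //; exists i.
have /choice[a aP] : forall S : set X, exists i, V S -> (i < m)%N /\ S `<=` U i.
  move=> S; have [VS|nVS] := pselect (V S); last by exists 0%N.
  by have [_ [i im <-] SU] := rV _ VS; exists i.
exists (fun i => \bigcup_(S in [set S | V S /\ a S = i]) S); split.
- by move=> i; apply: bigcup_open => S [VS _]; exact: oV.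
- move=> x; have : setT x by [].
  rewrite -cV => -[S VS Sx]; exists (a S); last by exists S.
  by have [] := aP _ VS.
- by move=> i x [S [VS <-]]; have [_] := aP _ VS; apply.
- move=> F x FW; have [k kN kP] := ordV x.
  have kN1 : (k <= N.+1)%N by move: kN; rewrite -[1]/(1%:Z) -PoszD lez_nat addn1.
  apply: leq_trans kN1.
  pose VV := [set S | V S /\ S x].
  have fVV : finite_set VV by apply: sub_finite_set fV => S [].
  apply: leq_trans (geq_card_fset_set kP); rewrite -/VV.
  apply: (@leq_trans #|` [fset a S | S in fset_set VV]%fset|); last first.
    exact: leq_imfset_card.
  apply: fsubset_leq_card; apply/fsubsetP => i iF.
  have [S [VS <-] Sx] := FW _ iF; apply: in_imfset.
  by rewrite /= in_fset_set// inE.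
- move=> i mi; apply/seteqP; split=> // x [S [VS aS] _].
  by have [] := aP _ VS; rewrite aS ltnNge mi.
Qed.

(** The hypothesis on the dimension only speaks of finite covers. The sets of a
    countable cover are therefore shrunk in stages. At stage m the sets of index
    less than m are already shrunk, and the single set st m stands for all the
    others. Splitting st m into a part in G m and the new remainder gives a
    finite cover, which is shrunk by [finite_shrink]. To make the process
    converge, the sets of index less than m are changed only inside the closure
    of st m. Since G is locally finite, this closure eventually leaves some
    neighbourhood of any given point, so that the process is locally
    stationary. *)
Lemma countable_shrink (G : nat -> set X) :
  (forall i, open (G i)) -> (forall x, exists i, G i x) -> locally_finite_family G ->
  exists V : nat -> set X, [/\ forall i, open (V i), forall x, exists i, V i x,
    forall i, V i `<=` G i & multiplicity_le V].
Proof.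
move=> oG cG lfG.
pose tail m := \bigcup_(j in [set j | (m <= j)%N]) G j.
pose inv m (st : nat -> set X) := [/\ forall i, open (st i),
  forall x, exists2 i, (i <= m)%N & st i x,
  forall i, (i < m)%N -> st i `<=` G i, st m `<=` tail m & multiplicity_le st].
pose rel m (st st' : nat -> set X) := forall i, (i < m)%N ->
  st' i `<=` st i /\ st i `\` closure (st m) `<=` st' i.
have /choice[next nextP] : forall mst : nat * (nat -> set X),
    exists st', inv mst.1 mst.2 -> inv mst.1.+1 st' /\ rel mst.1 mst.2 st'.
  move=> [m st] /=; have [[ost cst sG tst ordst]|ninv] := pselect (inv m st);
    last by exists st.
  (* the finite cover of stage m, with the set of the remainder split in two *)
  pose C i := if (i < m)%N then st i else if i == m then st m `&` G m else
    st m `&` tail m.+1.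
  have oC i : open (C i).
    rewrite /C; case: ifP => // _; case: ifP => _; first exact: openI.
    by apply: openI => //; exact: bigcup_open.
  have [//|x|W [oW cW WC ordW W0]] := @finite_shrink m.+2 C.
    have [i] := cst x; rewrite leq_eqVlt => /orP[/eqP ->|im] sti; last first.
      by exists i; [exact: ltn_trans im (leqnSn _)|rewrite /C im].
    have [j /= mj Gj] := tst x sti.
    move: mj; rewrite leq_eqVlt => /orP[/eqP mj|mj].
      by exists m; rewrite // /C ltnn eqxx; split=> //; rewrite mj.
    exists m.+1; rewrite // /C ltnNge leqnSn /= gtn_eqF//.
    by split=> //; exists j.
  pose st' i := if (i < m)%N then W i `|` (st i `\` closure (st m)) else W i.
  exists st' => _; split; last first.
    move=> i im; rewrite /st' im; split=> [x [/WC|[]//]|x]; last by right.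
    by rewrite /C im.
  split.
  - move=> i; rewrite /st'; case: ifP => // _; apply: openU => //.
    by apply: openI => //; apply: closed_openC; exact: closed_closure.
  - move=> x; have [i im Wi] := cW x; exists i => //.
    by rewrite /st'; case: ifP => //; left.
  - move=> i; rewrite ltnS leq_eqVlt => /orP[/eqP ->|im] x.
      by rewrite /st' ltnn => /WC; rewrite /C ltnn eqxx => -[].
    rewrite /st' im => -[/WC|[+ _]]; last exact: sG.
    by rewrite /C im; exact: sG.
  - move=> x; rewrite /st' ltnNge leqnSn /= => /WC.
    by rewrite /C ltnNge leqnSn /= gtn_eqF// => -[].
  - move=> F x Fst; have [clx|nclx] := pselect (closure (st m) x).
      apply: (ordW F x) => i /Fst; rewrite /st'; case: ifP => // _.
      by case=> // -[].
    apply: (ordst F x) => i /Fst; rewrite /st'; case: ifP => im.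
      by case=> [/WC|[]//]; rewrite /C im.
    move=> /WC; rewrite /C im; case: ifP => _ [stm _]; exfalso; apply: nclx;
      exact: subset_closure.
pose st := fix st m := if m is m'.+1 then next (m', st m')
  else (fun i : nat => if i == 0%N then setT else set0).
have stP m : inv m (st m).
  elim: m => [|m IHm] /=; last by have [] := nextP (m, st m) IHm.
  split=> //.
  - by move=> i /=; case: ifP => _; [exact: openT|exact: open0].
  - by move=> x; exists 0%N.
  - by move=> x _; have [i Gi] := cG x; exists i.
  - move=> F x Fst; apply: (@leq_trans 1%N) => //.
    rewrite -(cardfs1 0%N); apply: fsubset_leq_card; apply/fsubsetP => i /Fst.
    by rewrite /= inE; case: eqP.
have relP m : rel m (st m) (st m.+1).
  by have [] := nextP (m, st m) (stP m).
have st_dec i m n : (i < m)%N -> (m <= n)%N -> st n i `<=` st m i.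
  move=> im; elim: n => [|n IHn]; first by rewrite leqn0 => /eqP ->.
  rewrite leq_eqVlt => /orP[/eqP -> //|mn] x.
  by have [H _] := relP n i (leq_trans im mn) => /H/IHn; apply.
(* near x, the remainder is eventually empty, and later stages change nothing *)
have loc (x : X) : exists M, \forall y \near x, forall n i, (M <= n)%N ->
    (i < n)%N -> ~ st n n y /\ (st n i y -> st n.+1 i y).
  have [B Bx fB] := lfG x.
  have /finite_fsetP[E BE] := fB; exists (\max_(i <- E) i).+1.
  have := nbhs_interior Bx; apply: filterS => y By n i Mn im.
  have nB z : B z -> ~ st n n z.
    have [_ _ _ H _] := stP n => Bz /H[j /= nj Gj].
    have : [set` E] j by rewrite -BE; exists z.
    move=> /= jE; have := leq_trans Mn nj; rewrite ltnNge => /negP; apply.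
    exact: (@leq_bigmax_seq _ _ xpredT id).
  split; first by apply: nB; exact: interior_subset.
  have [_ H] := relP n i im => sti; apply: H; split=> //.
  by move=> /(_ _ By)[z [stz Bz]]; exact: nB stz.
have stable M (y : X) i m n : (forall n i, (M <= n)%N -> (i < n)%N ->
    ~ st n n y /\ (st n i y -> st n.+1 i y)) -> (M <= m)%N -> (i < m)%N ->
    (m <= n)%N -> st m i y -> st n i y.
  move=> H Mm im; elim: n => [|n IHn]; first by rewrite leqn0 => /eqP ->.
  rewrite leq_eqVlt => /orP[/eqP -> //|mn] /(IHn mn).
  by rewrite ltnS in mn; exact: (H n i (leq_trans Mm mn) (leq_trans im mn)).2.
exists (fun i => [set x | forall m, (i < m)%N -> st m i x]); split.
- move=> i; rewrite openE => x Vx; have [M HM] := loc x.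
  have iM : (i < maxn M i.+1)%N by rewrite leq_max ltnSn orbT.
  have : \forall y \near x, st (maxn M i.+1) i y.
    apply: open_nbhs_nbhs; split; last exact: Vx.
    by have [] := stP (maxn M i.+1).
  apply: filterS2 HM => y HM sty m im.
  have [mM|Mm] := leqP m (maxn M i.+1); first exact: st_dec sty.
  exact: (stable M y i _ _ HM (leq_maxl _ _) iM (ltnW Mm) sty).
- move=> x; have [M /nbhs_singleton HM] := loc x.
  have [_ cst _ _ _] := stP M.+1; have [i] := cst x.
  rewrite leq_eqVlt => /orP[/eqP -> /(HM M.+1 0%N _ _).1|iM sti].
    by case=> //; exact: leqnSn.
  exists i => m im; have [mM|Mm] := leqP m M.+1; first exact: st_dec sti.
  exact: (stable M x i _ _ HM (leqnSn _) iM (ltnW Mm) sti).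
- move=> i x /(_ i.+1 (ltnSn _)).
  by have [_ _ H _ _] := stP i.+1; exact: H.
- move=> F x FV; have [_ _ _ _ H] := stP (\max_(i <- F) i).+1.
  apply: (H F x) => i iF; apply: FV => //; rewrite ltnS.
  exact: (@leq_bigmax_seq _ _ xpredT id).
Qed.

End shrink_countable.

(** Dowker's and Ostrand's theorems together. A bump function for each point
    turns the cover into countably many disjoint families, one for each
    cardinality of the cells. Their unions G form a countable cover, which has a
    shrinking V of order at most N. The cells of bump functions for V then have
    at most N + 1 indices, hence N + 1 families suffice, and the composite of
    the two labels points to a set of the original cover. *)
Lemma ostrand_paracompact (R : realType) (X : topologicalType) (N : nat) :
  hausdorff_space X -> paracompact_space X -> covering_dim_le X N%:Z ->
  ostrand N X.
Proof.
move=> hX pX dX O oO O_.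
have [|q [cq q0 qO covq lfq]] := bump_functions hX pX R oO.
  by move=> x; exists x.
have [G [l [cG lG lfG _]]] := cell_labels cq lfq covq.
have oG n : open (G n).
  by rewrite openE => x /lG[_]; apply: filterS => y [].
have [V [oV cV VG ordV]] := countable_shrink dX oG cG lfG.
have [p [cp p0 pV covp lfp]] := bump_functions hX pX R oV cV.
have [A [k [cA kA _ sA]]] := cell_labels cp lfp covp.
have kG n x : A n x -> G (k n x) x.
  by move=> /kA[/pV/VG].
exists A, (fun n x => l (k n x) x); split.
  move=> x; have [n An] := cA x; exists n => //.
  have [F [Fn HF]] := sA n x An; rewrite -ltnS -Fn.
  by apply: (ordV F x) => i /HF/pV.
move=> n x An; have [qx lx] := lG _ _ (kG n x An); split; first exact: qO.
have [_] := kA n x An; apply: filterS2 lx => y [_ ly] [Any ->].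
by rewrite ly.
Qed.

(** * Disjoint families on compact subsets of Euclidean space *)

Lemma nbhs_subspace_inE (T : topologicalType) (A : set T) (x : T) : A x ->
  nbhs (x : subspace A) = within A (nbhs x).
Proof. by case: (nbhs_subspaceP A x). Qed.

Lemma nbhs_subspace_outE (T : topologicalType) (A : set T) (x : T) : ~ A x ->
  nbhs (x : subspace A) = globally [set x].
Proof. by case: (nbhs_subspaceP A x). Qed.

(** In [subspace A] the points outside A are isolated, so that a finite subcover
    of A is completed by singletons. *)
Lemma compact_subspace_paracompact (T : ptopologicalType) (A : set T) :
  compact A -> paracompact_space (subspace A).
Proof.
move=> cA UU [oU cU].
have cA' : compact (A : set (subspace A)).
  by rewrite -[A in compact A]setIid; apply/compact_subspaceIP; rewrite setIid.
move: cA'; rewrite compact_cover => /(_ (set (subspace A)) UU id).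
case=> [||D DU AD].
- by move=> U UUU; exact: oU.
- by move=> x Ax; have : setT x by []; rewrite -cU.
pose V1 := [set U `&` A | U in [set` D]].
pose V2 := [set [set x] | x in ~` A] : set (set (subspace A)).
exists (V1 `|` V2); split.
- split.
    move=> _ [[U DUi <-]|[x nAx <-]]; last exact: open_subspace1out.
    apply: openI; last exact: open_subspaceT.
    by apply: oU; have := DU _ DUi; rewrite inE.
  apply/seteqP; split=> // x _; have [Ax|nAx] := pselect (A x).
    have [U DUi Ux] := AD _ Ax; exists (U `&` A); last by [].
    by left; exists U.
  by exists [set x] => //; right; exists x.
- move=> _ [[U DUi <-]|[x nAx <-]].
    by exists U; [have := DU _ DUi; rewrite inE|move=> x []].
  have : setT x by [].
  by rewrite -cU => -[U UUU Ux]; exists U => // _ ->.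
- move=> x; have [Ax|nAx] := pselect (A x).
    exists A; first by apply: open_nbhs_nbhs; split=> //; exact: open_subspaceT.
    apply: (@sub_finite_set _ _ V1).
      by move=> V [[//|[y nAy <-]] [z [/= zy Az]]]; case: nAy; rewrite -zy.
    exact/finite_image/finite_fset.
  exists [set x]; first by apply: open_nbhs_nbhs; split=> //; exact: open_subspace1out.
  apply: (@sub_finite_set _ _ [set [set x]]) => //.
  move=> _ [[[U _ <-] [z [[_ Az] /= zx]]|[y nAy <-] [z [/= zy zx]]]].
    by case: nAx; rewrite -zx.
  by rewrite -zy zx.
Qed.

Section grid.
Context {R : realType} (m : nat).
Variable A : set 'rV[R]_m.
Hypothesis cA : compact A.

Lemma lebesgue_number (O : subspace A -> set (subspace A)) :
  (forall x, open (O x)) -> (forall x, O x x) ->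
  exists2 e : R, 0 < e & forall z, A z -> exists z1,
    forall w, A w -> ball z e w -> O z1 w.
Proof.
move=> oO O_.
have /compact_near_coveringP covA := cA.
have leb : \forall e \near (0 : R)^'+, A `<=` fun z => exists z1,
    forall w, A w -> ball z e w -> O z1 w.
  apply: covA => x Ax.
  have : nbhs (x : subspace A) (O x) by apply: open_nbhs_nbhs; split.
  rewrite nbhs_subspace_inE// /within /= => /nbhs_ballP[r /= r0 rO].
  have r20 : 0 < r / 2 by rewrite divr_gt0.
  exists (ball x (r / 2), [set e | e < r / 2]).
    by split; [exact: nbhsx_ballx|exact: nbhs_right_lt].
  move=> [z e] /= [xz er]; exists x => w Aw zw; apply: rO => //.
  rewrite [r]splitr; apply: ball_triangle xz _.
  exact: le_ball (ltW er) _ zw.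
have [e [/= e0 H]] := filter_ex (filterI (nbhs_right_gt 0) leb).
by exists e.
Qed.

Lemma affine_coord_continuous (c : 'I_m) (a b : R) :
  continuous (fun w : 'rV[R]_m => a * w ord0 c - b).
Proof.
move=> w.
have cw : continuous_at w (fun w : 'rV[R]_m => a * w ord0 c).
  apply: (@continuousM R _ (cst a) (fun w : 'rV[R]_m => w ord0 c) w).
    exact: cst_continuous.
  exact: coord_continuous.
exact: (continuousB cw (@cst_continuous _ _ b w)).
Qed.

Lemma near_floor (t : R) : (Num.floor t)%:~R != t ->
  \forall s \near t, (Num.floor s)%:~R != s /\ Num.floor s = Num.floor t.
Proof.
move=> tn; have lt : (Num.floor t)%:~R < t by rewrite lt_neqAle tn floor_le_tmp.
have : t \in `](Num.floor t)%:~R, (Num.floor t + 1)%:~R[.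
  by rewrite in_itv /= lt floorD1_gt.
move=> /near_in_itvoo; apply: filterS => s; rewrite in_itv /= => /andP[l u].
have fs : Num.floor s = Num.floor t by apply: floor_def; rewrite (ltW l) u.
by rewrite fs; split=> //; rewrite lt_eqF.
Qed.

(** Consider the m + 1 cubical grids of mesh 1 / L in which the grid of index i
    is shifted diagonally by i / (m + 1) of the mesh. The open cubes of a grid
    form a disjoint family. A point lies on a wall of the grid of index i when
    one of its m coordinates is special for i, and a coordinate is special for
    at most one i. So every point lies in an open cube of some grid. The cubes
    refine the cover when the mesh is less than a Lebesgue number. The label of
    a cube is read off at a base point g of the cube. *)
Lemma ostrand_compact : ostrand m (subspace A).
Proof.
move=> O oO O_; have [e e0 eP] := lebesgue_number oO O_.
have [L L0 Le] : exists2 L : R, 0 < L & L^-1 < e.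
  by exists (2 / e); rewrite ?divr_gt0// invf_div ltr_pdivrMr// ltr_pMr// ltr1n.
pose y (i : nat) (z : 'rV[R]_m) (c : 'I_m) := L * z ord0 c - i%:R / m.+1%:R.
pose fl i z : {ffun 'I_m -> int} := [ffun c => Num.floor (y i z c)].
pose B i := [set z | A z -> forall c, (Num.floor (y i z c))%:~R != y i z c].
have [z00] : inhabited 'rV[R]_m by constructor; exact: 0.
have /choice[g gP] : forall il : nat * {ffun 'I_m -> int},
    exists z, (exists2 z', A z' & fl il.1 z' = il.2) -> A z /\ fl il.1 z = il.2.
  move=> il; have [[z Az flz]|n] := pselect (exists2 z', A z' & fl il.1 z' = il.2).
    by exists z.
  by exists 0.
have /choice[a aP] : forall z, exists z1, A z ->
    forall w, A w -> ball z e w -> O z1 w.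
  move=> z; have [Az|nAz] := pselect (A z); last by exists 0.
  by have [z1 z1P] := eP z Az; exists z1.
exists B, (fun i z => if z \in A then a (g (i, fl i z)) else z); split.
  move=> z; apply: contrapT => nB.
  have /choice[h hP] : forall i : 'I_m.+1, exists c : 'I_m,
      (Num.floor (y i z c))%:~R = y i z c.
    move=> i; apply: contrapT => nc; apply: nB; exists i.
      by rewrite -ltnS.
    by move=> Az c; apply/eqP => yc; apply: nc; exists c.
  (* two grids i and j share a special coordinate, so (i - j) / (m + 1) is an
     integer *)
  have : ~ injective h.
    by move=> /leq_card; rewrite !card_ord => ?; lia.
  apply=> i j hij; have := hP i; have := hP j; rewrite -hij /y.
  set p := Num.floor _; set q := Num.floor _ => Hj Hi.
  have m0 : m.+1%:R != 0 :> R by rewrite pnatr_eq0.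
  have /intr_inj H : ((q - p) * m.+1%:Z)%:~R = (j%:Z - i%:Z)%:~R :> R.
    rewrite rmorphM !rmorphB /= Hi Hj.
    have -> : (m.+1%:Z)%:~R = m.+1%:R :> R by rewrite pmulrn.
    by field; rewrite addrC natr1.
  apply: val_inj; have := ltn_ord i; have := ltn_ord j.
  move=> jm im; case: (ltngtP (i : nat) j) => // ij.
  - have qp : (0 < q - p)%R.
      by rewrite -(@ltr_pM2r _ m.+1%:Z)// mul0r H subr_gt0 ltz_nat.
    have : (1 * m.+1%:Z <= (q - p) * m.+1%:Z)%R by rewrite ler_wpM2r.
    by rewrite H mul1r; lia.
  - have qp : (q - p < 0)%R.
      by rewrite -(@ltr_pM2r _ m.+1%:Z)// mul0r H subr_lt0 ltz_nat.
    have : ((q - p) * m.+1%:Z <= -1 * m.+1%:Z)%R by rewrite ler_wpM2r//; lia.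
    by rewrite H mulN1r; lia.
move=> i z Biz; have [Az|nAz] := pselect (A z); rewrite ?(mem_set Az) ?(memNset nAz); split.
- have [Ag flg] : A (g (i, fl i z)) /\ fl i (g (i, fl i z)) = fl i z.
    by apply: (gP (i, fl i z)); exists z.
  apply: aP => //; split=> // r c; rewrite (ord1 r); rewrite /ball /=.
  have := congr1 (fun f : {ffun _ -> _} => f c) flg; rewrite !ffunE.
  set u := g _ => fc.
  have := floor_le_tmp (y i z c); have := floorD1_gt (y i z c).
  have := floor_le_tmp (y i u c); have := floorD1_gt (y i u c).
  rewrite fc intrD /y; set F := (Num.floor _)%:~R; set d := i%:R / _.
  move=> h1 h2 h3 h4; apply: le_lt_trans Le.
  have : `|L * (u ord0 c - z ord0 c)| <= 1.
    by rewrite ler_norml; apply/andP; split; lra.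
  rewrite normrM gtr0_norm// -ler_pdivlMl// mulr1; exact.
- have Bnear : \forall w \near (z : 'rV[R]_m), forall c, [set: 'I_m] c ->
      (Num.floor (y i w c))%:~R != y i w c /\ Num.floor (y i w c) = Num.floor (y i z c).
    apply: (@near_finite _ (nbhs (z : 'rV[R]_m)) _ setT
      (fun c w => (Num.floor (y i w c))%:~R != y i w c
      /\ Num.floor (y i w c) = Num.floor (y i z c)) (nbhs_filter _)); first exact: finite_finset.
    move=> c _; have := near_floor (Biz Az c).
    have := @affine_coord_continuous c L (i%:R / m.+1%:R) z.
    by move=> /[apply].
  pose S := [set w | B i w /\
    (if w \in A then a (g (i, fl i w)) else w) = a (g (i, fl i z))].
  have W : within A (nbhs (z : 'rV[R]_m)) S.
    rewrite /within /=; apply: filterS Bnear => w H Aw.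
    split; first by move=> _ c; have [] := H c I.
    rewrite mem_set//; have -> // : fl i w = fl i z.
    by apply/ffunP => c; rewrite !ffunE; have [] := H c I.
  exact: (eq_ind_r (fun F : set_system _ => F S) W (nbhs_subspace_inE Az)).
- exact: O_.
- have W : globally [set z] [set w | B i w /\
    (if w \in A then a (g (i, fl i w)) else w) = z].
    by move=> w ->; split=> //=; rewrite memNset.
  exact: (eq_ind_r (fun F : set_system _ => F _) W (nbhs_subspace_outE nAz)).
Qed.

End grid.

(** * From spheres to boundaries of simplices *)

Section continuity_at.
Context {R : realType} {T : topologicalType}.
Implicit Types f g : T -> R.

Lemma continuous_atD f g x : continuous_at x f -> continuous_at x g ->
  continuous_at x (fun y => f y + g y).
Proof. by move=> cf cg; exact: (continuousD cf cg). Qed.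

Lemma continuous_atB f g x : continuous_at x f -> continuous_at x g ->
  continuous_at x (fun y => f y - g y).
Proof. by move=> cf cg; exact: (continuousB cf cg). Qed.

Lemma continuous_atM f g x : continuous_at x f -> continuous_at x g ->
  continuous_at x (fun y => f y * g y).
Proof. by move=> cf cg; exact: (continuousM cf cg). Qed.

Lemma continuous_atV f x : f x != 0 -> continuous_at x f ->
  continuous_at x (fun y => (f y)^-1).
Proof. by move=> fx cf; exact: (continuousV fx cf). Qed.

Lemma continuous_at_norm f x : continuous_at x f ->
  continuous_at x (fun y => `|f y|).
Proof. by move=> cf; apply: (continuous_comp cf); exact: norm_continuous. Qed.

Lemma continuous_at_sqrt f x : continuous_at x f ->
  continuous_at x (fun y => Num.sqrt (f y)).
Proof. by move=> cf; apply: (continuous_comp cf); exact: sqrt_continuous. Qed.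

Lemma continuous_at_sum (I : Type) (r : seq I) (F : I -> T -> R) x :
  (forall i, continuous_at x (F i)) ->
  continuous_at x (fun y => \sum_(i <- r) F i y).
Proof.
move=> cF; elim: r => [|i r IHr].
  by under [X in continuous_at _ X]eq_fun do rewrite big_nil; exact: cst_continuous.
under [X in continuous_at _ X]eq_fun do rewrite big_cons.
exact: continuous_atD.
Qed.

Lemma continuous_at_prod (I : Type) (r : seq I) (F : I -> T -> R) x :
  (forall i, continuous_at x (F i)) ->
  continuous_at x (fun y => \prod_(i <- r) F i y).
Proof.
move=> cF; elim: r => [|i r IHr].
  by under [X in continuous_at _ X]eq_fun do rewrite big_nil; exact: cst_continuous.
under [X in continuous_at _ X]eq_fun do rewrite big_cons.
exact: continuous_atM.
Qed.

Lemma continuous_at_row n (F : 'I_n -> T -> R) x :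
  (forall i, continuous_at x (F i)) ->
  continuous_at x (fun y => \row_i F i y : 'rV[R]_n).
Proof.
move=> cF A [P AP PA].
have : \forall y \near x, forall i, [set: 'I_n] i -> P ord0 i (F i y).
  apply: near_finite; first exact: finite_finset.
  by move=> i _; apply: cF; have := AP ord0 i; rewrite mxE.
by apply: filterS => y Py; apply: PA => i j; rewrite ord1 mxE; exact: Py.
Qed.

Lemma continuous_at_coord n (f : T -> 'rV[R]_n) i x : continuous_at x f ->
  continuous_at x (fun y => f y ord0 i).
Proof.
by move=> cf; exact: (continuous_comp cf (@coord_continuous _ _ _ ord0 i (f x))).
Qed.

End continuity_at.

Lemma within_comp (T U V : topologicalType) (A : set T) (B : set U)
    (f : T -> U) (g : U -> V) : (forall x, A x -> B (f x)) ->
  {within A, continuous f} -> {within B, continuous g} ->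
  {within A, continuous g \o f}.
Proof.
move=> AB /subspace_continuousP cf /subspace_continuousP cg.
apply/subspace_continuousP => x Ax W gW.
have H : nbhs x [set y | A y -> B (f y) -> W (g (f y))].
  exact: cf x Ax _ (cg _ (AB x Ax) W gW).
have : nbhs x [set y | A y -> W (g (f y))].
  by apply: filterS H => y Wy Ay; apply: Wy => //; exact: AB.
exact.
Qed.

Lemma sphere_compact (R : realType) k : compact (unit_sphere R k).
Proof.
apply: bounded_closed_compact.
  exists 1; split=> // M M1 u /= uS.
  have -> : `|u| = mx_norm u by []; rewrite mx_normrE; apply: bigmax_le => [|[i j] _ /=].
    by rewrite (le_trans ler01)// ltW.
  rewrite ord1; apply: le_trans (ltW M1).
  rewrite -(@ler_pXn2r _ 2)// ?nnegrE// expr1n real_normK ?num_real//.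
  rewrite -uS (bigD1 j)//= lerDl sumr_ge0// => l _.
  exact: sqr_ge0.
have -> : unit_sphere R k =
    (fun u : 'rV[R]_k.+1 => \sum_(i < k.+1) u ord0 i ^+ 2) @^-1` [set 1].
  by [].
have cs : continuous (fun u : 'rV[R]_k.+1 => \sum_(i < k.+1) u ord0 i ^+ 2).
  move=> u; apply: (continuous_at_sum _
    (F := fun i (u : 'rV[R]_k.+1) => u ord0 i ^+ 2)) => i.
  by apply: (continuous_atM (f := fun u : 'rV[R]_k.+1 => u ord0 i)
      (g := fun u : 'rV[R]_k.+1 => u ord0 i)); exact: coord_continuous.
move/continuous_closedP : cs; apply.
exact: accessible_closed_set1 (hausdorff_accessible (@Rhausdorff R)) 1.
Qed.

Definition std_simplex (R : realType) d : set 'rV[R]_d :=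
  [set t | (forall i, 0 <= t ord0 i) /\ \sum_i t ord0 i = 1].

Arguments std_simplex : clear implicits.

Definition std_simplex_boundary (R : realType) d : set 'rV[R]_d :=
  [set t | std_simplex R d t /\ exists i, t ord0 i = 0].

Arguments std_simplex_boundary : clear implicits.

(** The condition in [spheres_extend] for a single dimension k. *)
Definition sphere_ext (R : realType) (k : nat) (Y : topologicalType)
    (A B : set Y) :=
  forall g : 'rV[R]_k.+1 -> Y,
    {within unit_sphere R k, continuous g} ->
    g @` unit_sphere R k `<=` A ->
    exists h : 'rV[R]_k.+1 -> Y,
      [/\ {within unit_ball R k.+1, continuous h},
          h @` unit_ball R k.+1 `<=` B
        & forall u, unit_sphere R k u -> h u = g u].

Lemma sphere_extW (R : realType) k (Y : topologicalType) (A A' B B' : set Y) :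
  A' `<=` A -> B `<=` B' -> sphere_ext R k A B -> sphere_ext R k A' B'.
Proof.
move=> AA' BB' AB g cg gA; have [|h [ch hB hg]] := AB g cg.
  exact: subset_trans AA'.
by exists h; split=> //; exact: subset_trans BB'.
Qed.

Lemma sphere_nonempty (R : realType) k : unit_sphere R k !=set0.
Proof.
exists (\row_i (i == ord0)%:R); rewrite /unit_sphere /= (bigD1 ord0)//= mxE eqxx.
rewrite expr1n big1 ?addr0// => i i0.
by rewrite mxE (negbTE i0) expr0n.
Qed.

(** Constant maps of the sphere extend. *)
Lemma sphere_ext_sub (R : realType) k (Y : topologicalType) (A B : set Y) :
  sphere_ext R k A B -> A `<=` B.
Proof.
move=> AB a Aa; have [u Su] := sphere_nonempty R k.
have [||h [_ hB hg]] := AB (cst a).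
- by apply: continuous_subspaceT; exact: cst_continuous.
- by move=> _ [v _ <-].
rewrite -[a]/(cst a u) -hg//; apply: hB; exists u => //.
by rewrite /unit_ball /= Su.
Qed.

Lemma sphere_ext1 (R : realType) k (Y : topologicalType) (y : Y) :
  sphere_ext R k [set y] [set y].
Proof.
move=> g _ gy; exists (cst y); split.
- by apply: continuous_subspaceT; exact: cst_continuous.
- by move=> _ [v _ <-].
- by move=> u Su /=; rewrite (gy (g u))//; exists u.
Qed.

Section simplex_ext.
Context {R : realType} (k : nat).
Local Notation kk := (k.+2%:R : R).

Definition enorm (v : 'rV[R]_k.+1) := Num.sqrt (\sum_i v ord0 i ^+ 2).

Lemma enorm_ge0 v : 0 <= enorm v. Proof. exact: sqrtr_ge0. Qed.

Lemma enorm_sqr v : enorm v ^+ 2 = \sum_i v ord0 i ^+ 2.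
Proof. by rewrite sqr_sqrtr// sumr_ge0// => i _; exact: sqr_ge0. Qed.

Lemma enorm_eq0 v : enorm v = 0 -> v = 0.
Proof.
move=> v0; have := enorm_sqr v; rewrite v0 expr0n /= => /esym/eqP.
rewrite psumr_eq0; last by move=> i _; exact: sqr_ge0.
move=> /allP H; apply/rowP => i; rewrite mxE.
by have := H i; rewrite mem_index_enum sqrf_eq0 => /(_ isT)/eqP.
Qed.

Lemma enormZ a v : 0 <= a -> enorm (a *: v) = a * enorm v.
Proof.
move=> a0; rewrite /enorm; under eq_bigr do rewrite mxE exprMn.
by rewrite -mulr_sumr sqrtrM ?sqr_ge0// sqrtr_sqr ger0_norm.
Qed.

(** The position relative to the barycentre. The coordinates of a point of the
    simplex add up to 1, so the last one is omitted. *)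
Definition vcenter (t : 'rV[R]_k.+2) : 'rV[R]_k.+1 :=
  \row_i (t ord0 (lift ord_max i) - kk^-1).

(** A map of the simplex into the ball whose restriction to the boundary is the
    radial projection onto the sphere: on the boundary the product vanishes, and
    at the barycentre, where the norm vanishes, the product is positive. *)
Definition simplex_to_ball (t : 'rV[R]_k.+2) : 'rV[R]_k.+1 :=
  (enorm (vcenter t) + \prod_i t ord0 i)^-1 *: vcenter t.

(** Recovers the omitted coordinate of a vector of sum zero. *)
Definition zero_sum (w : 'rV[R]_k.+1) (j : 'I_k.+2) : R :=
  if unlift ord_max j is Some i then w ord0 i else - \sum_i w ord0 i.

(** The gauge of the simplex centred at its barycentre: k + 2 times the largest
    of the negative parts of the coordinates. It is 1 exactly for the
    translations w that lead from the barycentre to the boundary, as the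
    coordinates of the barycentre are all equal to 1 / (k + 2). *)
Definition gauge (w : 'rV[R]_k.+1) : R :=
  kk * `|\row_j ((`|zero_sum w j| - zero_sum w j) / 2) : 'rV[R]_k.+2|.

(** The point where the ray of direction w from the barycentre leaves the
    simplex. *)
Definition sphere_to_boundary (w : 'rV[R]_k.+1) : 'rV[R]_k.+2 :=
  \row_j (kk^-1 + zero_sum w j / gauge w).

Lemma sum_lift_max (F : 'I_k.+2 -> R) :
  \sum_j F j = \sum_i F (lift ord_max i) + F ord_max.
Proof.
rewrite big_ord_recr /=; congr (_ + _); apply: eq_bigr => i _.
by congr F; apply: val_inj; rewrite /= /bump leqNgt ltn_ord.
Qed.

Lemma zero_sum_sum w : \sum_j zero_sum w j = 0.
Proof.
rewrite sum_lift_max /zero_sum unlift_none.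
by under eq_bigr do rewrite liftK; rewrite subrr.
Qed.

Lemma zero_sumZ a w j : zero_sum (a *: w) j = a * zero_sum w j.
Proof.
rewrite /zero_sum; case: unliftP => [i _|_]; first by rewrite mxE.
by under eq_bigr do rewrite mxE; rewrite -mulr_sumr mulrN.
Qed.

Lemma zero_sum_vcenter t j : std_simplex R k.+2 t ->
  zero_sum (vcenter t) j = t ord0 j - kk^-1.
Proof.
move=> [_ t1]; rewrite /zero_sum; case: unliftP => [i ->|->].
  by rewrite mxE.
under eq_bigr do rewrite mxE.
move: t1; rewrite sum_lift_max sumrB sumr_const card_ord => t1.
have -> : kk^-1 *+ k.+1 = 1 - kk^-1.
  have k1 : k.+1%:R = kk - 1 by rewrite -[k.+2]addn1 natrD addrK.
  by rewrite -[LHS]mulr_natr k1 mulrBr mulr1 mulVf// pnatr_eq0.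
by move: t1; set S := \sum_i _; set K := kk^-1; lra.
Qed.

Lemma gaugeZ a w : 0 < a -> gauge (a *: w) = a * gauge w.
Proof.
move=> a0; rewrite /gauge mulrCA; congr (_ * _).
rewrite -[in RHS](gtr0_norm a0) -normrZ; congr `|_|.
apply/rowP => j; rewrite !mxE zero_sumZ normrM gtr0_norm//.
by ring.
Qed.

Lemma gauge_ub w j : - zero_sum w j <= gauge w / kk.
Proof.
rewrite /gauge mulrAC mulfV ?pnatr_eq0// mul1r.
set u := \row__ _.
have : `|u ord0 j| <= `|u|.
  have -> : `|u| = mx_norm u by [].
  by rewrite mx_normrE; apply: (le_bigmax _ (fun i => `|u i.1 i.2|) (ord0, j)).
apply: le_trans; rewrite mxE; apply: le_trans (ler_norm _).
have := ler_norm (- zero_sum w j); rewrite normrN.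
by lra.
Qed.

Lemma gauge_attained w : 0 < gauge w -> exists j, - zero_sum w j = gauge w / kk.
Proof.
rewrite /gauge mulrAC mulfV ?pnatr_eq0// mul1r.
set u := \row__ _ => u0.
have {}u0 : mx_norm u != 0.
  have -> : mx_norm u = `|u| by [].
  by apply: contraTneq u0 => ->; rewrite mulr0 ltxx.
have [[i j] uij] := mx_norm_neq0 u0; exists j.
have -> : `|u| = mx_norm u by [].
move: u0; rewrite uij /= ord1 mxE.
have [z0|z0] := lerP 0 (zero_sum w j).
  by rewrite (ger0_norm z0) subrr mul0r normr0 eqxx.
move=> _; rewrite (ltr0_norm z0) ger0_norm; first by field.
by lra.
Qed.

Lemma gauge_gt0 w : w != 0 -> 0 < gauge w.
Proof.
move=> w0; have [//|g0] := ltP 0 (gauge w).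
have H j : 0 <= zero_sum w j.
  rewrite -oppr_le0; apply: le_trans (gauge_ub w j) _.
  by rewrite pmulr_lle0// invr_gt0 ltr0n.
have /eqP := zero_sum_sum w; rewrite psumr_eq0// => /allP Hj.
case/eqP: w0; apply/rowP => i; rewrite mxE.
have := Hj (lift ord_max i); rewrite mem_index_enum => /(_ isT)/eqP.
by rewrite /zero_sum liftK.
Qed.

Lemma sphere_to_boundaryP w : w != 0 ->
  std_simplex_boundary R k.+2 (sphere_to_boundary w).
Proof.
move=> w0; have g0 := gauge_gt0 w0; split; first split.
- move=> j; rewrite mxE; have := gauge_ub w j.
  rewrite -(@ler_pM2r _ (gauge w)^-1) ?invr_gt0// -mulrA (mulrC kk^-1) mulrA.
  by rewrite mulfV ?gt_eqF// mul1r mulNr -subr_ge0 opprK.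
- under eq_bigr do rewrite mxE.
  rewrite big_split/= -mulr_suml zero_sum_sum mul0r addr0 sumr_const card_ord.
  by rewrite -[LHS]mulr_natr mulVf// pnatr_eq0.
- have [j Hj] := gauge_attained g0; exists j; rewrite mxE.
  have -> : zero_sum w j = - (gauge w / kk) by rewrite -Hj opprK.
  by rewrite mulNr mulrAC mulfV ?gt_eqF// mul1r subrr.
Qed.

Lemma simplex_to_ball_gt0 t : std_simplex R k.+2 t ->
  0 < enorm (vcenter t) + \prod_i t ord0 i.
Proof.
move=> St; have [t0 t1] := St; have p0 : 0 <= \prod_i t ord0 i by exact: prodr_ge0.
have [v0|v0] := eqVneq (enorm (vcenter t)) 0.
  rewrite v0 add0r; apply: prodr_gt0 => j _.
  have := zero_sum_vcenter j St; rewrite (enorm_eq0 v0).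
  rewrite -[X in zero_sum X](scale0r (0 : 'rV[R]_k.+1)) zero_sumZ mul0r.
  have : 0 < kk^-1 by rewrite invr_gt0 ltr0n.
  by move=> K0 /eqP; rewrite eq_sym subr_eq0 => /eqP ->.
have := enorm_ge0 (vcenter t); rewrite le_eqVlt eq_sym (negbTE v0) /=; lra.
Qed.

Lemma simplex_to_ballP t : std_simplex R k.+2 t ->
  unit_ball R k.+1 (simplex_to_ball t).
Proof.
move=> St; have d0 := simplex_to_ball_gt0 St; have [t0 _] := St.
rewrite /unit_ball /= -enorm_sqr expr_le1//; last exact: enorm_ge0.
rewrite /simplex_to_ball enormZ; last by rewrite invr_ge0 ltW.
rewrite ler_pdivrMl// mulr1.
by rewrite lerDl; exact: prodr_ge0.
Qed.

Lemma simplex_to_ball_boundary t : std_simplex_boundary R k.+2 t ->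
  unit_sphere R k (simplex_to_ball t) /\
  sphere_to_boundary (simplex_to_ball t) = t.
Proof.
move=> [St [j tj0]]; have d0 := simplex_to_ball_gt0 St; have [t0 t1] := St.
have p0 : \prod_i t ord0 i = 0 by rewrite (bigD1 j)//= tj0 mul0r.
move: d0; rewrite p0 addr0 => d0; rewrite /simplex_to_ball p0 addr0; split.
  rewrite /unit_sphere /= -enorm_sqr enormZ; last by rewrite invr_ge0 ltW.
  by rewrite mulVf ?gt_eqF// expr1n.
have kk0 : 0 < kk^-1 by rewrite invr_gt0 ltr0n.
have v0 : vcenter t != 0.
  by apply: contraTneq d0 => ->; rewrite -(scale0r (0 : 'rV[R]_k.+1)) enormZ// mul0r ltxx.
have g0 := gauge_gt0 v0.
have g1 : gauge (vcenter t) = 1.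
  have [i Hi] := gauge_attained g0; have := gauge_ub (vcenter t) j.
  move: Hi; rewrite !zero_sum_vcenter// tj0 sub0r opprK => Hi Hj.
  have : kk^-1 <= gauge (vcenter t) / kk <= kk^-1.
    by rewrite Hj -Hi opprB lerBlDr lerDl t0.
  rewrite -eq_le => /eqP /(congr1 ( *%R^~ kk)).
  by rewrite mulVf ?pnatr_eq0// mulfVK ?pnatr_eq0.
apply/rowP => i; rewrite mxE zero_sumZ gaugeZ ?invr_gt0// g1 mulr1.
rewrite mulrAC mulfV ?invr_eq0 ?gt_eqF// mul1r zero_sum_vcenter//.
by rewrite addrC subrK.
Qed.

Lemma enorm_continuous (T : topologicalType) (f : T -> 'rV[R]_k.+1) x :
  continuous_at x f -> continuous_at x (enorm \o f).
Proof.
move=> cf; apply: continuous_at_sqrt.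
apply: (continuous_at_sum _ (F := fun i y => f y ord0 i ^+ 2)) => i.
by apply: (continuous_atM (f := fun y => f y ord0 i) (g := fun y => f y ord0 i));
  exact: continuous_at_coord.
Qed.

Lemma simplex_to_ball_continuous (t : 'rV[R]_k.+2) :
  std_simplex R k.+2 t -> continuous_at t simplex_to_ball.
Proof.
move=> /simplex_to_ball_gt0 d0.
have cc i : continuous_at t (fun s : 'rV[R]_k.+2 => s ord0 i).
  exact: coord_continuous.
have cv : continuous_at t vcenter.
  apply: (continuous_at_row
    (F := fun i (s : 'rV[R]_k.+2) => s ord0 (lift ord_max i) - kk^-1)) => i.
  apply: (continuous_atB (g := cst kk^-1)) => //; exact: cst_continuous.
have cd : continuous_at t
    (fun s : 'rV[R]_k.+2 => (enorm (vcenter s) + \prod_i s ord0 i)^-1).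
  apply: (continuous_atV
    (f := fun s : 'rV[R]_k.+2 => enorm (vcenter s) + \prod_i s ord0 i)).
    by rewrite gt_eqF.
  apply: (continuous_atD (f := enorm \o vcenter)
    (g := fun s : 'rV[R]_k.+2 => \prod_i s ord0 i)).
    exact: enorm_continuous.
  exact: (continuous_at_prod _ (F := fun i (s : 'rV[R]_k.+2) => s ord0 i)).
have -> : simplex_to_ball = (fun s => \row_i
   ((enorm (vcenter s) + \prod_i s ord0 i)^-1 * vcenter s ord0 i)).
  by apply/funext => s; apply/rowP => i; rewrite !mxE.
apply: (continuous_at_row (F := fun i s =>
   (enorm (vcenter s) + \prod_i s ord0 i)^-1 * vcenter s ord0 i)) => i.
apply: (continuous_atM (g := fun s => vcenter s ord0 i)) => //.
exact: continuous_at_coord.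
Qed.

Lemma sphere_to_boundary_continuous (w : 'rV[R]_k.+1) :
  w != 0 -> continuous_at w sphere_to_boundary.
Proof.
move=> w0.
have cc i : continuous_at w (fun s : 'rV[R]_k.+1 => s ord0 i).
  exact: coord_continuous.
have cz j : continuous_at w (fun v => zero_sum v j).
  rewrite /zero_sum; case: unliftP => // _.
  under [X in continuous_at _ X]eq_fun do rewrite -[X in - X]subr0 opprB.
  apply: (continuous_atB (f := cst 0)
    (g := fun v : 'rV[R]_k.+1 => \sum_i v ord0 i)).
    exact: cst_continuous.
  exact: (continuous_at_sum _ (F := fun i (v : 'rV[R]_k.+1) => v ord0 i)).
have cg : continuous_at w gauge.
  apply: (continuous_atM (f := cst kk) (g := fun v : 'rV[R]_k.+1 =>
    `|\row_j ((`|zero_sum v j| - zero_sum v j) / 2) : 'rV[R]_k.+2|)).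
    exact: cst_continuous.
  have cr : continuous_at w (fun v : 'rV[R]_k.+1 =>
    \row_j ((`|zero_sum v j| - zero_sum v j) / 2) : 'rV[R]_k.+2).
    apply: (continuous_at_row (F := fun j v =>
      (`|zero_sum v j| - zero_sum v j) / 2)) => j.
    apply: (continuous_atM (f := fun v => `|zero_sum v j| - zero_sum v j)
      (g := cst 2^-1)); last exact: cst_continuous.
    apply: (continuous_atB (f := fun v => `|zero_sum v j|)
       (g := fun v => zero_sum v j)) => //.
    exact: continuous_at_norm.
  exact: (continuous_comp cr (@norm_continuous _ _ _)).
apply: (continuous_at_row (F := fun j v => kk^-1 + zero_sum v j / gauge v)) => j.
apply: (continuous_atD (f := cst kk^-1) (g := fun v => zero_sum v j / gauge v)).
  exact: cst_continuous.
apply: (continuous_atM (f := fun v => zero_sum v j) (g := fun v => (gauge v)^-1)).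
  exact: cz.
by apply: continuous_atV => //; rewrite gt_eqF// gauge_gt0.
Qed.

(** Compose with [simplex_to_ball], whose restriction to the boundary is
    inverted by [sphere_to_boundary]. *)
Lemma simplex_extension d (T : topologicalType) (A B : set T)
    (g : 'rV[R]_d -> T) : d = k.+2 -> sphere_ext R k A B ->
  {within std_simplex_boundary R d, continuous g} ->
  g @` std_simplex_boundary R d `<=` A ->
  exists h : 'rV[R]_d -> T, [/\ {within std_simplex R d, continuous h},
    h @` std_simplex R d `<=` B &
    forall t, std_simplex_boundary R d t -> h t = g t].
Proof.
move=> dk; subst d.
have sphere0 u : unit_sphere R k u -> u != 0.
  move=> u1; apply/eqP => u0; move: u1; rewrite u0 /unit_sphere /= big1.
    by move/esym/eqP; rewrite oner_eq0.
  by move=> i _; rewrite mxE expr0n.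
move=> AB cg gA; have [||h [ch hB hg]] := AB (g \o sphere_to_boundary).
- apply: within_comp cg => [u Su|].
    exact/sphere_to_boundaryP/sphere0.
  apply: continuous_in_subspaceT => u; rewrite inE => Su.
  exact/sphere_to_boundary_continuous/sphere0.
- move=> _ [u Su <-]; apply: gA; exists (sphere_to_boundary u) => //.
  exact/sphere_to_boundaryP/sphere0.
exists (h \o simplex_to_ball); split.
- apply: within_comp ch => [t St|]; first exact: simplex_to_ballP.
  apply: continuous_in_subspaceT => t; rewrite inE => St.
  exact: simplex_to_ball_continuous.
- move=> _ [t St <-]; apply: hB; exists (simplex_to_ball t) => //.
  exact: simplex_to_ballP.
- move=> t Bt; have [St tt] := simplex_to_ball_boundary Bt.
  by rewrite /= hg// /= tt.
Qed.

End simplex_ext.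

(** * Selections for chains of lower locally constant maps *)

Lemma finite_ffuns (I : finType) (T : choiceType) (D : set T) :
  finite_set D -> finite_set [set s : {ffun I -> T} | forall i, D (s i)].
Proof.
move=> /finite_fsetP[E ->].
pose F (g : {ffun I -> E}) : {ffun I -> T} := [ffun i => val (g i)].
apply: sub_finite_set (finite_image F (@finite_finset _ setT)) => s /= sE.
exists [ffun i => [` sE i]%fset] => //.
by apply/ffunP => i; rewrite !ffunE.
Qed.

(** Finitely many members meet a neighbourhood of x, and those whose closures
    avoid x can be avoided on a smaller one. *)
Lemma locally_finite_near_closure (X : topologicalType) (I : choiceType) (U : I -> set X)
    (x : X) : locally_finite_family U ->
  \forall y \near x, forall i, closure (U i) y -> closure (U i) x.
Proof.
move=> /locally_finite_closure lfU; have [B Bx fB] := lfU x.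
have H : \forall y \near x, forall i,
    [set i | closure (U i) `&` B !=set0] i -> closure (U i) y -> closure (U i) x.
  apply: near_finite => // i _.
  have [cx|ncx] := pselect (closure (U i) x); first exact: nearW.
  have : nbhs x (~` closure (U i)).
    by apply: open_nbhs_nbhs; split=> //; apply/closed_openC/closed_closure.
  by apply: filterS => y ncy.
by apply: filterS2 Bx H => y By Hy i cy; apply: Hy => //; exists y.
Qed.

Lemma within_closed_cover (I : finType) (T V : topologicalType)
    (A : set T) (C : I -> set T) (f : T -> V) :
  (forall i, closed (C i)) -> (forall x, A x -> exists i, C i x) ->
  (forall i, {within C i, continuous f}) -> {within A, continuous f}.
Proof.
move=> clC AC cf; apply/subspace_continuousP => x Ax W fW.
have H : \forall y \near x, forall i, [set: I] i -> C i y -> W (f y).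
  apply: near_finite; first exact: finite_finset.
  move=> i _; have [Cx|nCx] := pselect (C i x).
    by have /subspace_continuousP/(_ _ Cx)/(_ _ fW) := cf i.
  have : nbhs x (~` C i) by apply: open_nbhs_nbhs; split=> //; exact: closed_openC.
  by apply: filterS => y nCy.
have : nbhs x [set y | A y -> W (f y)].
  by apply: filterS H => y Hy Ay; have [i Ci] := AC y Ay; exact: (Hy i).
exact.
Qed.

Section faces.
Context {R : realType} (N : nat).
Implicit Types (J : {set 'I_N.+1}) (t : 'rV[R]_N.+1).

Definition supp t : {set 'I_N.+1} := [set i | t ord0 i != 0]%SET.

(** Points of the N-simplex are weights on the levels 0, ..., N. *)
Definition face J : set 'rV[R]_N.+1 :=
  [set t | std_simplex R N.+1 t /\ supp t \subset J].

Lemma face_out J t i : face J t -> i \notin J -> t ord0 i = 0.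
Proof.
move=> [_ /fintype.subsetP tJ]; apply: contraNeq => ti; apply: tJ.
by rewrite inE.
Qed.

Definition face_coord J (t : 'rV[R]_N.+1) : 'rV[R]_#|J| :=
  \row_l t ord0 (enum_val l).

Definition face_point J (r : 'rV[R]_#|J|) : 'rV[R]_N.+1 :=
  \row_i \sum_(l | enum_val l == i) r ord0 l.

Lemma face_point_val J (r : 'rV[R]_#|J|) l :
  face_point r ord0 (enum_val l) = r ord0 l.
Proof.
rewrite mxE (bigD1 l)//= big1 ?addr0// => l' /andP[/eqP/enum_val_inj ->].
by rewrite eqxx.
Qed.

Lemma face_point_out J (r : 'rV[R]_#|J|) i : i \notin J ->
  face_point r ord0 i = 0.
Proof.
move=> iJ; rewrite mxE big1// => l /eqP li.
by rewrite -li enum_valP in iJ.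
Qed.

Lemma face_coordK J t : face J t -> face_point (face_coord J t) = t.
Proof.
move=> Ft; apply/rowP => i; have [iJ|iJ] := boolP (i \in J).
  by rewrite -(enum_rankK_in iJ iJ) face_point_val mxE.
by rewrite face_point_out// (face_out Ft).
Qed.

Lemma sum_face J t : (forall i, i \notin J -> t ord0 i = 0) ->
  \sum_i t ord0 i = \sum_(l < #|J|) t ord0 (enum_val l).
Proof.
move=> tJ; rewrite (bigID (mem J))/= [X in _ + X]big1 ?addr0; last first.
  by move=> i; exact: tJ.
by rewrite big_enum_val.
Qed.

Lemma face_point_continuous J : continuous (@face_point J).
Proof.
move=> r; apply: (continuous_at_row
  (F := fun i (r : 'rV[R]_#|J|) => \sum_(l | enum_val l == i) r ord0 l)) => i.
under [X in continuous_at _ X]eq_fun do rewrite big_mkcond.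
apply: (continuous_at_sum _ (F := fun l (r : 'rV[R]_#|J|) =>
   if enum_val l == i then r ord0 l else 0)) => l.
by case: (enum_val l == i); [exact: coord_continuous|exact: cst_continuous].
Qed.

Lemma face_coord_continuous J : continuous (face_coord J).
Proof.
move=> t; apply: (continuous_at_row
  (F := fun l t => t ord0 (enum_val l))) => l.
exact: coord_continuous.
Qed.

Lemma face_closed J : closed (face J).
Proof.
have cc i : continuous (fun t : 'rV[R]_N.+1 => t ord0 i) by exact: coord_continuous.
have -> : face J = \bigcap_(i in [set: 'I_N.+1])
      ((fun t : 'rV[R]_N.+1 => t ord0 i) @^-1` [set x | 0 <= x]) `&`
    (fun t : 'rV[R]_N.+1 => \sum_i t ord0 i) @^-1` [set 1] `&`
    \bigcap_(i in [set i | i \notin J])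
      ((fun t : 'rV[R]_N.+1 => t ord0 i) @^-1` [set 0]).
  apply/seteqP; split=> t.
    move=> Ft; have [[t0 t1] _] := Ft; split; first by split=> [i _|]; [exact: t0|exact: t1].
    by move=> i /= iJ; exact: face_out Ft iJ.
  move=> [[t0 t1] tJ]; split; first by split; [move=> i; exact: t0|exact: t1].
  apply/fintype.subsetP => i; rewrite inE; apply: contraNT => iJ.
  by apply/eqP; exact: tJ.
have cs : continuous (fun t : 'rV[R]_N.+1 => \sum_i t ord0 i).
  move=> t; apply: (continuous_at_sum _
    (F := fun i (t : 'rV[R]_N.+1) => t ord0 i)) => i; exact: coord_continuous.
have c1 (a : R) : closed [set a].
  exact: accessible_closed_set1 (hausdorff_accessible (@Rhausdorff R)) a.
apply: closedI; first apply: closedI.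
- apply: closed_bigI => i _; move/continuous_closedP : (cc i); apply.
  exact: closed_ge.
- by move/continuous_closedP : cs; apply.
- by apply: closed_bigI => i _; move/continuous_closedP : (cc i); apply.
Qed.

Lemma face_compact J : compact (face J).
Proof.
apply: bounded_closed_compact.
  exists 1; split=> // M M1 t [[t0 t1] _] /=.
  have -> : `|t| = mx_norm t by [].
  rewrite mx_normrE; apply: bigmax_le => [|[i j] _ /=].
    by rewrite (le_trans ler01)// ltW.
  rewrite ord1 ger0_norm//; apply: le_trans (ltW M1).
  by rewrite -t1 (bigD1 j)//= lerDl sumr_ge0.
exact: face_closed.
Qed.

Lemma face_coord_simplex J t : face J t -> std_simplex R #|J| (face_coord J t).
Proof.
move=> Ft; have [[t0 t1] _] := Ft; split=> [l|]; first by rewrite mxE.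
by under eq_bigr do rewrite mxE; rewrite -sum_face// => i; exact: face_out.
Qed.

Lemma face_point_face J J' (r : 'rV[R]_#|J|) : std_simplex R #|J| r ->
  (forall l, enum_val l \notin J' -> r ord0 l = 0) -> face J' (face_point r).
Proof.
move=> [r0 r1] rJ'; split; first split.
- by move=> i; rewrite mxE sumr_ge0.
- rewrite -r1 (@sum_face J); last by move=> i; exact: face_point_out.
  by apply: eq_bigr => l _; rewrite face_point_val.
- apply/fintype.subsetP => i; rewrite inE; apply: contraNT => iJ'.
  have [iJ|iJ] := boolP (i \in J); last by rewrite face_point_out.
  rewrite -(enum_rankK_in iJ iJ) face_point_val rJ'//.
  by rewrite enum_rankK_in.
Qed.

Lemma supp_neq0 t : std_simplex R N.+1 t -> supp t != finset.set0.
Proof.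
move=> [t0 t1]; apply/eqP => t_0; move/eqP: t1; rewrite big1.
  by rewrite eq_sym oner_eq0.
move=> i _; apply/eqP; apply: contraTT isT => ti.
have : i \in supp t by rewrite inE.
by rewrite t_0 inE.
Qed.

End faces.

Section selection.
Context {R : realType} {X T : topologicalType} (N : nat).
Hypotheses (hX : hausdorff_space X) (pX : paracompact_space X).
Hypothesis oX : ostrand N X.
Variable Psi : nat -> X -> set T.
Hypothesis Psi0 : forall x, Psi 0 x !=set0.
Hypothesis Psi_ext : forall k x, (k < N)%N ->
  sphere_ext R k (Psi k x) (Psi k.+1 x).
Hypothesis Psi_llc : forall k x (K : set T), compact K -> K `<=` Psi k x ->
  \forall y \near x, K `<=` Psi k y.

Local Notation labels := {ffun 'I_N.+1 -> X}.
Implicit Types (U : 'I_N.+1 -> X -> set X) (s : labels) (J : {set 'I_N.+1}).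
Implicit Types (u : labels -> 'rV[R]_N.+1 -> T).

(** A label s chooses on each level j the member U j (s j) of the cover, that
    is, a vertex. Here x is a common point of the closures of the vertices on
    the levels in J, which therefore span a simplex. *)
Definition in_closures U s J x := forall j, j \in J -> closure (U j (s j)) x.

(** Compatibility with faces: u is a map on the union of all simplices, so its
    value is determined by the vertices of non-zero weight. *)
Definition support_local u := forall s s' (t : 'rV[R]_N.+1),
  (forall j, t ord0 j != 0 -> s j = s' j) -> u s t = u s' t.

(** The simplex with vertices s on J, of dimension #|J|.-1, is mapped
    continuously into the corresponding set at x. *)
Definition fits u s J x := {within face J, continuous (u s)} /\
  u s @` face J `<=` Psi #|J|.-1 x.

Definition levels_below (i : nat) J := forall j, j \in J -> (j < i)%N.

Definition covers_upto i U := forall j : 'I_N.+1, (j < i)%N ->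
  (forall x, exists y, U j y x) /\ (forall y, open (U j y)) /\ locally_finite_family (U j).

(** The map u is constructed on the simplices with vertices on the levels less
    than i. *)
Definition stage i U u := support_local u /\ forall s J x, levels_below i J -> J != finset.set0 ->
  in_closures U s J x -> fits u s J x.

(** In addition, cones with vertices on level i are available, up to K vertices.
    The cover of level i is not chosen yet: a vertex s i of that level is
    only a point, at which the other vertices have to meet and at which the
    inclusions are required. *)
Definition cone_stage (i : 'I_N.+1) K U u := stage i U u /\
  forall s J, levels_below i.+1 J -> i \in J -> (#|J| <= K)%N ->
    in_closures U s (J :\ i) (s i) -> fits u s J (s i).

(** A new simplex J has its boundary already mapped: the facet opposite to the
    vertex of level i by the previous stage, the others by the induction on
    the number of vertices. Their images lie in Psi k (s i) with k + 2 the
    number of vertices, so that the extension property applies. A simplex with a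
    single vertex is sent to a point of Psi 0. *)
Lemma cone_step (i : 'I_N.+1) K U u :
  cone_stage i K U u -> exists u', cone_stage i K.+1 U u'.
Proof.
move=> [[lu Su] Cu].
pose new s J := [/\ levels_below i.+1 J, i \in J, #|J| = K.+1 &
  in_closures U s (J :\ i) (s i)].
(* forget the vertices that do not belong to the simplex, for the extension to
   depend on the simplex only *)
pose norm J s : labels := [ffun j => if j \in J then s j else s i].
have Hex : forall Js : {set 'I_N.+1} * labels,
  exists h : 'rV[R]_#|Js.1| -> T, new Js.2 Js.1 ->
    [/\ {within std_simplex R #|Js.1|, continuous h},
        forall r, std_simplex R #|Js.1| r -> Psi K (Js.2 i) (h r) &
        forall t, face Js.1 t -> supp t != Js.1 -> h (face_coord Js.1 t) = u Js.2 t].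
  move=> [J s] /=; have [[bJ iJ cJ comJ]|nn] := pselect (new s J); last first.
    by exists (fun r => u s (face_point r)).
  have supp_sub (t : 'rV[R]_N.+1) : face J t -> supp t != J -> exists2 j, j \in J & t ord0 j = 0.
    move=> Ft tJ; have [_ sJ] := Ft; apply: contrapT => nj; case/negP: tJ.
    rewrite finset.eqEsubset sJ; apply/fintype.subsetP => j jJ.
    by rewrite inE; apply/eqP => tj; apply: nj; exists j.
  case: K new cJ Cu bJ => [|k] new cJ Cu bJ.
    have [y y0] := Psi0 (s i); exists (fun=> y) => _; split=> //.
      by apply: continuous_subspaceT; exact: cst_continuous.
    move=> t Ft /(supp_sub t Ft)[j jJ tj].
    have := supp_neq0 Ft.1; have [_ sJ] := Ft.
    have : (#|supp t| < 1)%N.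
      rewrite -cJ; apply: proper_card; apply/properP; split=> //.
      by exists j => //; rewrite inE tj eqxx.
    by rewrite ltnS leqn0 cards_eq0 => ->.
  have kN : (k < N)%N.
    by rewrite -2!ltnS -cJ; have := max_card (mem J); rewrite card_ord ltnS.
  have facet l : l \in J -> fits u s (J :\ l) (s i).
    move=> lJ; have cJl : #|J :\ l| = k.+1.
      by have := cardsD1 l J; rewrite lJ cJ => -[].
    have comS J' : J' \subset (J :\ i) -> in_closures U s J' (s i).
      by move=> /fintype.subsetP sub j /sub; exact: comJ.
    have [->|li] := eqVneq l i.
      apply: Su => //.
        move=> j; rewrite !inE => /andP[ji /bJ]; rewrite ltnS leq_eqVlt.
        by case/orP => // /eqP/val_inj ji'; rewrite ji' eqxx in ji.
      by rewrite -cards_eq0; have := cardsD1 i J; rewrite iJ cJ add1n => -[<-].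
    apply: Cu; rewrite ?cJl//.
    - by move=> j; rewrite !inE => /andP[_ /bJ].
    - by rewrite !inE eq_sym li.
    - by apply: comS; apply: finset.setSD; exact: subD1set.
  have facetK l : l \in J -> #|J :\ l|.-1 = k.
    by move=> lJ; have := cardsD1 l J; rewrite lJ cJ add1n => -[<-].
  have bdry (r : 'rV[R]_#|J|) : std_simplex_boundary R #|J| r ->
      exists l : 'I_#|J|, face (J :\ enum_val l) (face_point r).
    move=> [Sr [l rl]]; exists l; apply: face_point_face => // l'.
    rewrite !inE enum_valP andbT negbK => /eqP/enum_val_inj -> //.
  have [||h [ch hB hg]] := simplex_extension (g := fun r => u s (@face_point R N J r))
      cJ (@Psi_ext k (s i) kN).
  - apply: (within_closed_cover (C := fun l : 'I_#|J| =>
      @face_point R N J @^-1` face (J :\ enum_val l))) => //.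
    + move=> l; have /continuous_closedP := @face_point_continuous R N J; apply.
      exact: face_closed.
    + move=> l; have [cu _] := facet _ (enum_valP l).
      apply: within_comp cu => //; apply: continuous_subspaceT.
      exact: face_point_continuous.
  - move=> _ [r Br <-]; have [l Fl] := bdry r Br.
    have [_] := facet _ (enum_valP l); rewrite facetK ?enum_valP//.
    by apply; exists (face_point r).
  exists h => _; split=> //.
  - by move=> r Sr; apply: hB; exists r.
  - move=> t Ft /(supp_sub t Ft)[j jJ tj]; rewrite hg ?face_coordK//.
    split; first exact: face_coord_simplex.
    by exists (enum_rank_in jJ j); rewrite mxE enum_rankK_in.
pose H Js := sval (cid (Hex Js)); have HP Js := svalP (cid (Hex Js)).
have norm_eq J s j : j \in J -> norm J s j = s j by move=> jJ; rewrite ffunE jJ.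
have new_norm J s : new s J -> new (norm J s) J.
  move=> [bJ iJ cJ comJ]; split=> // j; rewrite !inE => /andP[ji jJ].
  by rewrite !norm_eq//; apply: comJ; rewrite !inE ji.
(* extend u to the interiors of the new simplices *)
pose u' s t := if pselect (new s (supp t)) is left _
  then H (supp t, norm (supp t) s) (face_coord (supp t) t) else u s t.
have suppJ J (t : 'rV[R]_N.+1) : face J t -> supp t \subset J by case.
have u'old s J (t : 'rV[R]_N.+1) : i \notin J \/ (#|J| <= K)%N -> face J t -> u' s t = u s t.
  move=> iJK Ft; rewrite /u'; case: pselect => // -[_ it ct _].
  have st := suppJ _ _ Ft; case: iJK => [iJ|JK].
    by move/fintype.subsetP/(_ _ it): st; rewrite (negbTE iJ).
  by have := leq_trans (subset_leq_card st) JK; rewrite ct ltnn.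
have u'new s J (t : 'rV[R]_N.+1) : new s J -> face J t ->
    u' s t = H (J, norm J s) (face_coord J t).
  move=> nsJ Ft; have [_ iJ cJ _] := nsJ; have st := suppJ _ _ Ft.
  have [E|tJ] := eqVneq (supp t) J.
    by rewrite /u' E; case: pselect.
  have [_ _ HB] := HP (J, norm J s) (new_norm _ _ nsJ).
  rewrite /H HB//=.
  rewrite /u'; case: pselect => [[_ _ ct _]|_ /=]; last first.
    apply: lu => j tj; rewrite norm_eq//.
    by apply: (fintype.subsetP st); rewrite inE.
  by case/eqP: tJ; apply/eqP; rewrite eqEcard st cJ ct leqnn.
have lu' : support_local u'.
  move=> s s' t ss'.
  have nn s1 s2 : (forall j, t ord0 j != 0 -> s1 j = s2 j) ->
      new s1 (supp t) -> new s2 (supp t).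
    move=> s12 [bt it ct comt]; have s12i : s1 i = s2 i.
      by apply: s12; move: it; rewrite inE.
    split=> // j jt; rewrite -s12i -s12; first exact: comt.
    by move: jt; rewrite !inE => /andP[].
  rewrite /u'; case: pselect => [n1|n1]; case: pselect => [n2|n2].
  - have -> // : norm (supp t) s = norm (supp t) s'.
    apply/ffunP => j; rewrite !ffunE; case: ifP => [|_].
      by rewrite inE; exact: ss'.
    by have [_ it _ _] := n1; apply: ss'; move: it; rewrite inE.
  - by case: n2; exact: nn n1.
  - by case: n1; apply: nn n2 => j tj; rewrite ss'.
  - exact: lu.
have fits_old s J x : i \notin J \/ (#|J| <= K)%N -> fits u s J x -> fits u' s J x.
  move=> iJK [cu uP]; split; last first.
    by move=> _ [t Ft <-]; rewrite (u'old s J)//; apply: uP; exists t.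
  apply: subspace_eq_continuous cu => t; rewrite inE => Ft.
  exact/esym/(u'old s J t iJK Ft).
exists u'; split; first split=> // s J x bJ J0 comJ.
  apply: fits_old; last exact: Su.
  by left; apply/negP => /bJ; rewrite ltnn.
move=> s J bJ iJ; rewrite leq_eqVlt => /orP[/eqP cJ|cJ] comJ; last first.
  by apply: fits_old; [right|exact: Cu].
have nsJ : new s J by [].
have [cH HB _] := HP (J, norm J s) (new_norm _ _ nsJ); split.
  have : {within face J, continuous (H (J, norm J s) \o face_coord J)}.
    apply: within_comp cH => [t Ft|]; first exact: face_coord_simplex.
    by apply: continuous_subspaceT; exact: face_coord_continuous.
  apply: subspace_eq_continuous => t; rewrite inE => Ft.
  exact/esym/(u'new s J t nsJ Ft).
move=> _ [t Ft <-]; rewrite (u'new s J)// cJ /=.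
by rewrite -(norm_eq J s i iJ); apply: HB; exact: face_coord_simplex.
Qed.

Lemma cone_stages (i : 'I_N.+1) U u : stage i U u ->
  exists u', cone_stage i N.+1 U u'.
Proof.
move=> Su; have : forall K, exists u', cone_stage i K U u'.
  elim=> [|K [u' Cu']]; last exact: cone_step Cu'.
  exists u; split=> // s J _ iJ; rewrite leqn0 cards_eq0 => /eqP J0.
  by rewrite J0 inE in iJ.
exact.
Qed.

(** The sets G x are the neighbourhoods on which the cones with vertex x remain
    admissible. There are only finitely many cones, each with compact image.
    The second condition makes sure that a simplex whose vertices have a common
    point y, among them the vertex x of level i, is such a cone: the other
    vertices must then also meet at x. *)
Lemma stage_step (i : 'I_N.+1) U u : covers_upto i U -> stage i U u ->
  exists U' u', covers_upto i.+1 U' /\ stage i.+1 U' u'.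
Proof.
move=> cU /cone_stages[u' [[lu Su] Cu]].
pose G x := [set y |
  (forall s J, s i = x -> levels_below i.+1 J -> i \in J ->
    in_closures U s (J :\ i) x -> u' s @` face J `<=` Psi #|J|.-1 y) /\
  (forall j : 'I_N.+1, (j < i)%N -> forall z, closure (U j z) y -> closure (U j z) x)].
have GP x : nbhs x (G x).
  (* the vertices that occur in some cone with vertex x *)
  pose D := [set y | y = x] `|` \bigcup_(j in [set j : 'I_N.+1 | (j < i)%N])
    [set y | closure (U j y) x].
  have fD : finite_set D.
    rewrite finite_setU; split; first exact: finite_set1.
    apply: bigcup_finite; first exact: finite_finset.
    move=> j /= ji; have [_ [_ /locally_finite_closure/(_ x)[B /nbhs_singleton Bx fB]]] := cU j ji.
    by apply: sub_finite_set fB => y cy; exists x.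
  have H1 : \forall y \near x, forall Js : {set 'I_N.+1} * labels,
      (setT `*` [set s : labels | forall j, D (s j)]) Js ->
      Js.2 i = x -> levels_below i.+1 Js.1 -> i \in Js.1 ->
      in_closures U Js.2 (Js.1 :\ i) x -> u' Js.2 @` face Js.1 `<=` Psi #|Js.1|.-1 y.
    apply: near_finite.
      by apply: finite_setX; [exact: finite_finset|exact: finite_ffuns].
    move=> [J s] _ /=.
    have [[six bJ iJ comJ]|n] :=
      pselect [/\ s i = x, levels_below i.+1 J, i \in J & in_closures U s (J :\ i) x]; last first.
      by apply: nearW => y six bJ iJ comJ; exfalso; apply: n.
    have cJ : (#|J| <= N.+1)%N by have := max_card (mem J); rewrite card_ord.
    have [|cu uP] := Cu s J bJ iJ cJ; first by rewrite six.
    rewrite six in uP.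
    have := Psi_llc (continuous_compact cu (@face_compact R N J)) uP.
    by apply: filterS.
  have H2 : \forall y \near x, forall j : 'I_N.+1, [set j : 'I_N.+1 | (j < i)%N] j ->
      forall z, closure (U j z) y -> closure (U j z) x.
    apply: near_finite; first exact: finite_finset.
    by move=> j /= ji; have [_ [_ lfj]] := cU j ji; exact: locally_finite_near_closure.
  apply: filterS2 H1 H2 => y H1 H2; split=> // s J six bJ iJ comJ.
  pose s' : labels := [ffun j => if j \in J then s j else x].
  have ss' t : face J t -> u' s t = u' s' t.
    move=> Ft; apply: lu => j tj; rewrite ffunE ifT//.
    by apply: contraNT tj => jJ; rewrite (face_out Ft).
  have s'i : s' i = x by rewrite ffunE iJ.
  have Hs' : u' s' @` face J `<=` Psi #|J|.-1 y.
    apply: (H1 (J, s')) => //=.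
      split=> //= j; rewrite ffunE; case: ifP => jJ; last by left.
      have [->|ji] := eqVneq j i; first by left.
      right; exists j => /=; last by apply: comJ; rewrite !inE ji.
      have := bJ j jJ; rewrite ltnS leq_eqVlt => /orP[/eqP/val_inj ji'|//].
      by rewrite ji' eqxx in ji.
    by move=> j jJ; rewrite ffunE; have := jJ; rewrite !inE => /andP[_ ->]; exact: comJ.
  by move=> _ [t Ft <-]; rewrite ss'//; apply: Hs'; exists t.
have [||V [oV cV VG lfV]] := paracompact_shrink hX pX (O := fun x => (G x)°).
- by move=> x; exact: open_interior.
- by move=> x; exists x; exact: GP.
exists (fun j => if j == i then V else U j), u'; split.
  move=> j; rewrite ltnS leq_eqVlt => /orP[/eqP/val_inj ->|ji]; first by rewrite eqxx.
  by rewrite ifN; [exact: cU|apply: contraTneq ji => ->; rewrite ltnn].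
split=> // s J x bJ J0 comJ.
have ltJ j : j \in J -> j != i -> (j < i)%N.
  move=> jJ ji; have := bJ j jJ; rewrite ltnS leq_eqVlt => /orP[/eqP/val_inj E|//].
  by rewrite E eqxx in ji.
have [iJ|iJ] := boolP (i \in J).
  have := comJ i iJ; rewrite eqxx => /VG/interior_subset[G1 G2].
  have comi : in_closures U s (J :\ i) (s i).
    move=> j; rewrite !inE => /andP[ji jJ]; apply: G2; first exact: ltJ.
    by have := comJ j jJ; rewrite (negbTE ji).
  have cJ : (#|J| <= N.+1)%N by have := max_card (mem J); rewrite card_ord.
  by have [cu _] := Cu s J bJ iJ cJ comi; split=> //; exact: G1.
have nei j : j \in J -> j != i by move=> jJ; apply: contraNneq iJ => <-.
apply: Su => // [j jJ|j jJ]; first by apply: ltJ => //; exact: nei.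
by have := comJ j jJ; rewrite (negbTE (nei j jJ)).
Qed.

Lemma all_stages : exists U u, covers_upto N.+1 U /\ stage N.+1 U u.
Proof.
have H i : (i <= N.+1)%N -> exists U u, covers_upto i U /\ stage i U u.
  elim: i => [_|i IHi iN].
    have [[x0 _]|nX] := pselect (exists x : X, True).
      have [y0 _] := Psi0 x0.
      exists (fun _ _ => set0), (fun _ _ => y0); split=> //; split=> // s J x J0.
      by move=> /finset.set0Pn[j /J0].
    have F (s : labels) : False by apply: nX; exists (s ord0).
    exists (fun _ _ => set0), (fun s _ => False_rect T (F s)); split=> //.
    by split=> s; case: (F s).
  have [U [u [cU Su]]] := IHi (ltnW iN).
  exact: (@stage_step (Ordinal iN) U u).
exact: H.
Qed.

(** The disjoint families provide barycentric coordinates: the weight of level i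
    is positive only on A i, where the label is locally constant. *)
Lemma ostrand_partition (O : X -> set X) :
  (forall x, open (O x)) -> (forall x, O x x) ->
  exists (p : X -> 'rV[R]_N.+1) (c : 'I_N.+1 -> X -> X),
    [/\ continuous p, forall x, std_simplex R N.+1 (p x) &
      forall i x, p x ord0 i != 0 -> O (c i x) x /\
        \forall y \near x, c i y = c i x].
Proof.
move=> oO O_; have [A [c [cA cP]]] := oX oO O_.
have [||q [cq q0 qA covq _]] := bump_functions hX pX R (O := fun i : 'I_N.+1 => A i).
- by move=> i; rewrite openE => x /cP[_]; apply: filterS => y [].
- by move=> x; have [n nN An] := cA x; exists (Ordinal (nN : (n < N.+1)%N)).
have sq x : 0 < \sum_i q i x.
  have [i qi] := covq x; rewrite (bigD1 i)//=.
  by rewrite ltr_pwDl// sumr_ge0.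
exists (fun x => \row_i (q i x / \sum_j q j x)), (fun i => c i); split.
- move=> x; apply: (continuous_at_row (F := fun i x => q i x / \sum_j q j x)) => i.
  apply: (continuous_atM (f := q i)); first exact: cq.
  apply: (continuous_atV (f := fun x => \sum_j q j x)); first by rewrite gt_eqF.
  by apply: (continuous_at_sum _ (F := q)) => j; exact: cq.
- move=> x; split=> [i|]; first by rewrite mxE divr_ge0// ltW.
  under eq_bigr do rewrite mxE.
  by rewrite -mulr_suml mulfV// gt_eqF.
- move=> i x; rewrite mxE mulf_eq0 negb_or => /andP[qi _].
  have [|Oc cx] := cP i x; first by apply: qA; rewrite lt_neqAle eq_sym qi q0.
  by split=> //; apply: filterS cx => y [].
Qed.

(** The selection maps x to the point with weights p x on the simplex of the
    labels of x. Near x the labels of positive weight at x are constant. The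
    others take finitely many values, and on each of the resulting simplices
    the map is continuous and agrees at x with the value of the selection. *)
Theorem chain_selection :
  exists f : X -> T, continuous f /\ forall x, Psi N x (f x).
Proof.
have [U [u [cU [lu Su]]]] := all_stages.
have {}cU j : (forall x, exists y, U j y x) /\
    (forall y, open (U j y)) /\ locally_finite_family (U j).
  exact: cU.
have /choice[a aP] : forall jx : 'I_N.+1 * X, exists y, U jx.1 y jx.2.
  by move=> [j x]; have [+ _] := cU j; exact.
have [||p [c [cp Sp cP]]] := @ostrand_partition
    (fun x => \bigcap_(j in [set: 'I_N.+1]) U j (a (j, x))).
- move=> x; rewrite openE => y Hy.
  have : \forall z \near y, forall j, [set: 'I_N.+1] j -> U j (a (j, x)) z.
    apply: near_finite; first exact: finite_finset.
    move=> j _; apply: open_nbhs_nbhs; split; last exact: Hy.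
    by have [_ [+ _]] := cU j; exact.
  by apply: filterS.
- by move=> x j _; exact: (aP (j, x)).
pose lab x : labels := [ffun j => a (j, c j x)].
have sP x : in_closures U (lab x) (supp (p x)) x.
  move=> j; rewrite inE ffunE => /cP[H _]; apply: subset_closure; exact: H.
have pF x : face (supp (p x)) (p x) by [].
have fitsp s J x : J != finset.set0 -> in_closures U s J x -> fits u s J x.
  by move=> J0 comJ; apply: Su => // j _.
exists (fun x => u (lab x) (p x)); split; last first.
  move=> x; have [_ uP] := fitsp (lab x) (supp (p x)) x (supp_neq0 (Sp x)) (sP x).
  have mono k m : (m <= N)%N -> (k <= m)%N -> Psi k x `<=` Psi m x.
    elim: m => [_|m IHm mN]; first by rewrite leqn0 => /eqP ->.
    rewrite leq_eqVlt ltnS => /orP[/eqP -> //|km] y /(IHm (ltnW mN) km).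
    exact: sphere_ext_sub (@Psi_ext m x mN) y.
  apply: (mono #|supp (p x)|.-1) => //; last by apply: uP; exists (p x).
  have := max_card (mem (supp (p x))); rewrite card_ord.
  by case: #|_|.
move=> x W fW.
pose D := \bigcup_(j in [set: 'I_N.+1]) [set y | closure (U j y) x] `|` [set x].
have fD : finite_set D.
  rewrite finite_setU; split; last exact: finite_set1.
  apply: bigcup_finite; first exact: finite_finset.
  move=> j _; have [_ [_ /locally_finite_closure/(_ x)[B /nbhs_singleton Bx fB]]] := cU j.
  by apply: sub_finite_set fB => y cy; exists x.
have H1 : \forall y \near x, forall j, [set: 'I_N.+1] j ->
    forall z, closure (U j z) y -> closure (U j z) x.
  apply: near_finite; first exact: finite_finset.
  by move=> j _; have [_ [_ lfj]] := cU j; exact: locally_finite_near_closure.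
have cpj j : continuous_at x (fun y => p y ord0 j).
  by apply: continuous_at_coord; exact: cp.
have H2 : \forall y \near x, forall j, [set: 'I_N.+1] j ->
    p x ord0 j != 0 -> p y ord0 j != 0 /\ lab y j = lab x j.
  apply: near_finite; first exact: finite_finset.
  move=> j _; have [pj0|pj] := eqVneq (p x ord0 j) 0; first exact: nearW.
  have pgt : 0 < p x ord0 j by rewrite lt_neqAle eq_sym pj; have [-> _] := Sp x.
  have cj : p y ord0 j @[y --> x] --> p x ord0 j := cpj j.
  have N1 := cvgr_gt _ cj _ pgt; have [_ N2] := cP j x pj.
  by apply: filterS2 (N1 _) N2 => y py cy _; rewrite gt_eqF// !ffunE cy.
(* continuity at x along each of the finitely many simplices that matter *)
have H3 : \forall y \near x, forall Js : {set 'I_N.+1} * labels,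
    (setT `*` [set s : labels | forall j, D (s j)]) Js ->
    in_closures U Js.2 Js.1 x -> (forall j, p x ord0 j != 0 -> j \in Js.1 /\ Js.2 j = lab x j) ->
    face Js.1 (p y) -> W (u Js.2 (p y)).
  apply: near_finite.
    by apply: finite_setX; [exact: finite_finset|exact: finite_ffuns].
  move=> [J s'] _ /=.
  have [[comJ sJ]|n] := pselect (in_closures U s' J x /\
      (forall j, p x ord0 j != 0 -> j \in J /\ s' j = lab x j)); last first.
    by apply: nearW => y comJ sJ; exfalso; apply: n.
  have Fx : face J (p x).
    split=> //; apply/fintype.subsetP => j; rewrite inE => pj.
    by have [] := sJ j pj.
  have J0 : J != finset.set0.
    apply: contraTneq (supp_neq0 (Sp x)) => J0; rewrite negbK -finset.subset0.
    by rewrite -J0; case: Fx.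
  have [cu _] := fitsp s' J x J0 comJ.
  have usx : u s' (p x) = u (lab x) (p x) by apply: lu => j /sJ[].
  have fW' : nbhs (u s' (p x)) W by rewrite usx.
  have /subspace_continuousP cu' := cu.
  have cW : nbhs (p x) [set t | face J t -> W (u s' t)] := cu' _ Fx _ fW'.
  have N1 : nbhs x [set y | face J (p y) -> W (u s' (p y))] := cp x _ cW.
  by apply: filterS N1 => y Wy _ _ /Wy.
have : nbhs x [set y | W (u (lab y) (p y))]; last by [].
apply: filterS3 H1 H2 H3 => y H1 H2 H3 /=.
pose s' : labels := [ffun j => if p y ord0 j != 0 then lab y j else x].
have -> : u (lab y) (p y) = u s' (p y).
  by apply: lu => j pj; rewrite [s' j]ffunE pj.
have coms : in_closures U s' (supp (p y)) x.
  move=> j jy; apply: H1 => //; rewrite ffunE; have := jy; rewrite inE => ->.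
  exact: sP.
apply: (H3 (supp (p y), s')) => //=.
- split=> //= j; rewrite ffunE; case: ifPn => [pj|_]; last by right.
  left; exists j => //=; have := coms j; rewrite inE => /(_ pj).
  by rewrite ffunE pj.
- by move=> j /(H2 j I)[pj sj]; rewrite inE [s' j]ffunE pj.
Qed.

End selection.

(** * Moduli of extension in metric spaces *)

(** The tube lemma: an open graph gives lower local constancy. *)
Lemma open_graph_llc (X E : topologicalType) (P : X -> set E) (x : X)
    (K : set E) : (forall e, P x e -> \forall e' \near e & x' \near x, P x' e') ->
  compact K -> K `<=` P x -> \forall y \near x, K `<=` P y.
Proof.
move=> oP /compact_near_coveringP covK KP.
by apply: covK => e /KP; exact: oP.
Qed.

Definition set_ball (R : realType) (E : Type) (D : E -> E -> R) (e : E) (r : R) :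
  set E := [set e' | D e e' < r].

Section metric.
Context {R : realType} {E : topologicalType} (D : E -> E -> R).
Hypotheses (mD : is_metric D) (tD : metric_induces_topology D).

Lemma dist_ge0 x y : 0 <= D x y. Proof. by have [+ _ _ _] := mD; exact. Qed.
Lemma distxx x : D x x = 0. Proof. by have [_ /(_ x x)[_ ->]] := mD. Qed.
Lemma dist_sym x y : D x y = D y x. Proof. by have [_ _ + _] := mD; exact. Qed.
Lemma dist_triangle y x z : D x z <= D x y + D y z.
Proof. by have [_ _ _ +] := mD; exact. Qed.

Lemma near_dist (x : E) (r : R) : 0 < r -> \forall y \near x, D x y < r.
Proof. by move=> r0; apply/tD; exists r. Qed.

Lemma dist_continuousP (T : topologicalType) (f : T -> E) (x : T) :
  continuous_at x f <-> forall r, 0 < r -> \forall y \near x, D (f x) (f y) < r.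
Proof.
split=> [cf r r0|H A /tD[r r0 rA]].
  exact: cf (near_dist _ r0).
by apply: filterS (H r r0) => y fy; exact: rA.
Qed.

Lemma dist_within_continuousP (T : topologicalType) (A : set T) (f : T -> E) :
  {within A, continuous f} <-> forall x, A x -> forall r, 0 < r ->
    \forall y \near x, A y -> D (f x) (f y) < r.
Proof.
split=> [/subspace_continuousP cf x Ax r r0|H].
  exact: cf x Ax _ (near_dist (f x) r0).
apply/subspace_continuousP => x Ax W /tD[r r0 rW].
have : nbhs x [set y | A y -> W (f y)].
  by apply: filterS (H x Ax r r0) => y fy Ay; apply: rW; exact: fy.
exact.
Qed.

Variable SS : set (set E).

(** Moduli are variable radii. Unlike arbitrary positive functions on the union
    of SS, they vary in a controlled way and are defined on the whole space.
    The bound by 1 keeps balls in the range where they are convex. *)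
Definition modulus (g : E -> R) := [/\ forall e, 0 <= g e <= 1,
  forall e e', g e <= g e' + D e e' & forall S y, SS S -> S y -> 0 < g y].

Lemma modulusM a g : 0 < a <= 1 -> modulus g -> modulus (fun e => a * g e).
Proof.
move=> /andP[a0 a1] [g01 gL gp]; split.
- by move=> e; have := g01 e; nra.
- by move=> e e'; have := gL e e'; have := dist_ge0 e e'; nra.
- by move=> S y SSS Sy; rewrite mulr_gt0//; exact: gp Sy.
Qed.

Lemma modulus_min g h : modulus g -> modulus h ->
  modulus (fun e => Num.min (g e) (h e)).
Proof.
move=> [g01 gL gp] [h01 hL hp]; split.
- move=> e; have := g01 e; have := h01 e => /andP[h0 h1] /andP[g0 g1].
  by rewrite le_min g0 h0 ge_min g1.
- move=> e e'; rewrite addr_minl le_min !ge_min.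
  by rewrite gL hL orbT.
- by move=> S y SSS Sy; rewrite lt_min (gp S)// (hp S).
Qed.

Lemma modulus_cst a : 0 < a <= 1 -> modulus (fun=> a).
Proof.
move=> /andP[a0 a1]; split=> [_|e e'|S y _ _ //]; first by rewrite ltW.
by rewrite lerDl; exact: dist_ge0.
Qed.

(** Replaces pointwise radii by a modulus: if the modulus is positive at e, the
    ball of that radius at e lies in the ball of radius d y at some point y
    of a member of SS. Taking half of the supremum ensures that a single y is
    found without the supremum being attained. *)
Lemma modulus_below (d : E -> R) :
  (forall S y, SS S -> S y -> 0 < d y <= 1) ->
  exists2 g, modulus g & forall e, 0 < g e ->
    exists S y, [/\ SS S, S y & g e < d y - D e y].
Proof.
move=> d01.
pose V e := [set r | r = 0 \/ exists S y, [/\ SS S, S y & r = d y - D e y]].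
have V0 e : V e 0 by left.
have ubV e : ubound (V e) 1.
  move=> _ [->//|[S [y [SSS Sy ->]]]].
  by have := d01 S y SSS Sy; have := dist_ge0 e y; lra.
have supV e : has_sup (V e) by split; [exists 0|exists 1].
have supge0 e : 0 <= sup (V e) by apply: sup_upper_bound.
have suple1 e : sup (V e) <= 1 by apply: sup_le_ub; [exists 0|].
exists (fun e => sup (V e) / 2).
  split.
  - by move=> e; have := supge0 e; have := suple1 e; lra.
  - move=> e e'; have : sup (V e) <= sup (V e') + D e e'.
      apply: sup_le_ub; first by exists 0.
      move=> _ [->|[S [y [SSS Sy ->]]]].
        by rewrite addr_ge0// dist_ge0.
      have : d y - D e' y <= sup (V e').
        by apply: sup_upper_bound => //; right; exists S, y.
      have := dist_triangle e e' y; rewrite (dist_sym e' e).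
      by lra.
    by have := dist_ge0 e e'; lra.
  - move=> S y SSS Sy; rewrite divr_gt0//.
    have : d y <= sup (V y).
      apply: sup_upper_bound => //; right; exists S, y; split=> //.
      by rewrite distxx subr0.
    by apply: lt_le_trans; have /andP[] := d01 S y SSS Sy.
move=> e ge0; have s0 : 0 < sup (V e) by move: ge0; rewrite pmulr_lgt0// invr_gt0.
have [r [r0|[S [y [SSS Sy rE]]]] lr] := sup_adherent ge0 (supV e).
  by move: lr; rewrite r0; lra.
by exists S, y; split=> //; rewrite -rE; lra.
Qed.

Section equi.
Variable n : int.
Hypothesis eLC : equi_LC R n SS.

(** Equi-local connectedness with uniform sizes. If d y is the radius obtained at
    y for the neighbourhood of radius g y / 4, then a ball of small radius at
    e lies in a ball at a nearby y; the spheres in it are filled within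
    g y / 4 of y, hence within g e of e because g is 1-Lipschitz. *)
Lemma extension_modulus (g : E -> R) : modulus g -> exists r, [/\ modulus r,
  forall e, r e <= g e & forall e S k, SS S -> k%:Z <= n ->
    sphere_ext R k (set_ball D e (r e) `&` S) (set_ball D e (g e) `&` S)].
Proof.
move=> [g01 gL gp].
have /choice[d dP] : forall y, exists d : R, (exists2 S, SS S & S y) ->
    [/\ 0 < d, d <= g y / 4 & forall S k, SS S -> k%:Z <= n ->
      sphere_ext R k (set_ball D y d `&` S) (set_ball D y (g y / 4) `&` S)].
  move=> y; have [[S0 SS0 S0y]|nS] := pselect (exists2 S, SS S & S y); last first.
    by exists 0.
  have gy0 : 0 < g y / 4 by rewrite divr_gt0//; exact: gp S0y.
  have [_ /(_ y _ (set_ball D y (g y / 4)))[||V [Vy VU VP]]] := eLC.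
  - by exists S0.
  - exact: near_dist.
  have /tD[r r0 rV] := Vy.
  exists (Num.min r (g y / 4)) => _; split.
  - by rewrite lt_min r0.
  - by rewrite ge_min lexx orbT.
  - move=> S k SSS kn; apply: (@sphere_extW _ _ _ (V `&` S)) (VP S SSS k kn) => //.
    by apply: setSI => z; rewrite /set_ball /= lt_min => /andP[zr _]; exact: rV.
have dP' S y : SS S -> S y -> [/\ 0 < d y, d y <= g y / 4 & forall S k, SS S -> k%:Z <= n ->
      sphere_ext R k (set_ball D y (d y) `&` S) (set_ball D y (g y / 4) `&` S)].
  by move=> SSS Sy; apply: dP; exists S.
have [|r gr rP] := @modulus_below (fun y => d y / 2).
  move=> S y SSS Sy; have [d0 d1 _] := dP' S y SSS Sy.
  by have := g01 y; lra.
exists r; split=> //.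
  move=> e; have [r0|r0] := ltP 0 (r e).
    have [S [y [SSS Sy re]]] := rP e r0; have [d0 d1 _] := dP' S y SSS Sy.
    by have := gL y e; rewrite (dist_sym y e); have := g01 y; lra.
  by apply: le_trans r0 _; have /andP[] := g01 e.
move=> e S k SSS kn h ch hA.
have r0 : 0 < r e.
  have [u Su] := sphere_nonempty R k.
  have [+ _] := hA (h u) (ex_intro2 _ _ u Su erefl).
  by apply: le_lt_trans; exact: dist_ge0.
have [S' [y [SSS' Sy re]]] := rP e r0; have [d0 d1 dext] := dP' S' y SSS' Sy.
apply: (sphere_extW _ _ (dext S k SSS kn)) hA => //.
- apply: setSI => z; rewrite /set_ball /=; have := dist_triangle e y z.
  by rewrite (dist_sym y e); lra.
- apply: setSI => z; rewrite /set_ball /=; have := dist_triangle y e z.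
  have := gL y e; rewrite (dist_sym y e).
  by have := dist_ge0 e y; lra.
Qed.

End equi.
End metric.

(** * Gluing along segments and approximation of spheres *)

(** The two inequalities say that balls of radius at most 1 are convex and that
    segments depend continuously on their ends and on the parameter. The
    restriction to close points is there for metrics that are truncated at 1,
    as [sup_dist] below. *)
Definition segments (R : realType) (E : Type) (D : E -> E -> R)
    (seg : E -> E -> R -> E) :=
  [/\ forall a b, seg a b 0 = a, forall a b, seg a b 1 = b,
      forall a b c t r, 0 <= t <= 1 -> r <= 1 -> D c a < r -> D c b < r ->
        D c (seg a b t) < r &
      forall a b a' b' t t', D a b < 1 -> 0 <= t <= 1 -> 0 <= t' <= 1 ->
        D (seg a b t) (seg a' b' t') <= D a a' + D b b' + `|t - t'|].

Section gluing.
Context {R : realType} {E : topologicalType} (D : E -> E -> R).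
Variable seg : E -> E -> R -> E.
Hypotheses (mD : is_metric D) (tD : metric_induces_topology D).
Hypothesis segD : segments D seg.

Lemma within_seg (T : topologicalType) (A : set T) (a b : T -> E) (t : T -> R) :
  (forall x, A x -> D (a x) (b x) < 1) -> (forall x, A x -> 0 <= t x <= 1) ->
  {within A, continuous a} -> {within A, continuous b} ->
  {within A, continuous t} ->
  {within A, continuous (fun x => seg (a x) (b x) (t x))}.
Proof.
have [_ _ _ segc] := segD.
move=> ab t01 /(dist_within_continuousP tD) ca /(dist_within_continuousP tD) cb.
move=> /subspace_continuousP ct; apply/(dist_within_continuousP tD) => x Ax r r0.
have r30 : 0 < r / 3 by rewrite divr_gt0.
have ctx : \forall y \near x, A y -> `|t x - t y| < r / 3.
  by have := ct x Ax _ (@nbhsx_ballx _ _ (t x) (r / 3) r30).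
have := ca x Ax _ r30; have := cb x Ax _ r30; move: ctx; apply: filterS3.
move=> y ty by_ ay Ay; have := segc _ _ (a y) (b y) (t x) (t y) (ab x Ax) (t01 x Ax) (t01 y Ay).
by have := ty Ay; have := by_ Ay; have := ay Ay; lra.
Qed.

(** If g' is close to g and h' fills g', then g is filled by h' on the ball of
    radius 1/2, scaled by 2, followed by the segments from g' to g on the
    remaining shell. *)
Lemma ball_glue k (g g' h' : 'rV[R]_k.+1 -> E) (B : set E) :
  {within unit_sphere R k, continuous g} ->
  {within unit_sphere R k, continuous g'} ->
  {within unit_ball R k.+1, continuous h'} ->
  h' @` unit_ball R k.+1 `<=` B ->
  (forall u, unit_sphere R k u -> h' u = g' u) ->
  (forall u, unit_sphere R k u -> D (g' u) (g u) < 1) ->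
  (forall u t, unit_sphere R k u -> 0 <= t <= 1 -> B (seg (g' u) (g u) t)) ->
  exists h : 'rV[R]_k.+1 -> E,
      [/\ {within unit_ball R k.+1, continuous h},
          h @` unit_ball R k.+1 `<=` B
        & forall u, unit_sphere R k u -> h u = g u].
Proof.
have [seg0 seg1 _ _] := segD.
move=> cg cg' ch' hB hg' gg' segB.
have ballE v : unit_ball R k.+1 v <-> enorm v <= 1.
  by rewrite /unit_ball /= -enorm_sqr expr_le1// enorm_ge0.
have sphE v : unit_sphere R k v <-> enorm v = 1.
  rewrite /unit_sphere /= -enorm_sqr; split=> [/eqP|->]; last by rewrite expr1n.
  by rewrite sqrf_eq1 => /orP[/eqP//|/eqP v1]; have := enorm_ge0 v; rewrite v1; lra.
have ce : continuous (@enorm R k).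
  by move=> v; apply: (@enorm_continuous R k _ idfun v); exact: cvg_id.
pose dir (v : 'rV[R]_k.+1) := (enorm v)^-1 *: v.
have dirS v : 1 / 2 <= enorm v -> unit_sphere R k (dir v).
  move=> v2; apply/sphE; rewrite enormZ ?invr_ge0 ?enorm_ge0// mulVf//.
  by rewrite gt_eqF//; lra.
pose h1 v := h' (2 *: v).
pose h2 v := seg (g' (dir v)) (g (dir v)) (2 * enorm v - 1).
pose h v := if enorm v <= 1 / 2 then h1 v else h2 v.
pose A1 := [set v : 'rV[R]_k.+1 | enorm v <= 1 / 2].
pose A2 := [set v : 'rV[R]_k.+1 | 1 / 2 <= enorm v] `&` [set v | enorm v <= 1].
have clA1 : closed A1.
  by move/continuous_closedP : ce => /(_ [set x | x <= 1 / 2]); apply; exact: closed_le.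
have clA2 : closed A2.
  move/continuous_closedP : ce => ce'; apply: closedI.
    by apply: (ce' [set x | 1 / 2 <= x]); exact: closed_ge.
  by apply: (ce' [set x | x <= 1]); exact: closed_le.
have h1A v : A1 v -> unit_ball R k.+1 (2 *: v).
  by rewrite /A1 /= => v2; apply/ballE; rewrite enormZ//; lra.
have t01 v : A2 v -> 0 <= 2 * enorm v - 1 <= 1.
  by move=> [/= v1 v2]; lra.
have hA2 v : A2 v -> h v = h2 v.
  move=> [/= v1 v2]; rewrite /h; case: ifPn => // v3.
  have v12 : enorm v = 1 / 2 by apply/eqP; rewrite eq_le v1 v3.
  have dv : dir v = 2 *: v by rewrite /dir v12 div1r invrK.
  rewrite /h1 /h2 v12 (_ : 2 * (1 / 2) - 1 = 0) ?seg0; last by field.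
  by rewrite -hg' ?dv// -dv; apply: dirS; rewrite v12.
have scal_cont (T : topologicalType) (a : T -> R) (f : T -> 'rV[R]_k.+1) x :
    continuous_at x a -> continuous_at x f -> continuous_at x (fun y => a y *: f y).
  move=> ca cf.
  have -> : (fun y => a y *: f y) = (fun y => \row_i (a y * f y ord0 i)).
    by apply/funext => y; apply/rowP => i; rewrite !mxE.
  apply: (continuous_at_row (F := fun i y => a y * f y ord0 i)) => i.
  apply: (continuous_atM (g := fun y => f y ord0 i)) => //.
  exact: continuous_at_coord.
exists h; split.
- have -> : unit_ball R k.+1 = A1 `|` A2.
    apply/seteqP; split=> v; rewrite ballE /A1 /A2 /=.
      move=> v1; have [v2|v2] := leP (enorm v) (1 / 2); first by left.
      by right; split=> //; exact: ltW.
    by move=> [v2|[//]]; lra.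
  apply: withinU_continuous => //.
    have c1 : {within A1, continuous h1}.
      apply: within_comp ch' => //; apply: continuous_subspaceT => v.
      apply: (scal_cont _ (cst 2) idfun); first exact: cst_continuous.
      exact: cvg_id.
    apply: subspace_eq_continuous c1 => v; rewrite inE /A1 /= => v2.
    by rewrite /from_subspace /h v2.
  have cdir : {within A2, continuous dir}.
    apply: continuous_in_subspaceT => v; rewrite inE => -[/= v1 v2].
    apply: (scal_cont _ (fun v => (enorm v)^-1) idfun); last exact: cvg_id.
    by apply: continuous_atV; [rewrite gt_eqF//; lra|exact: ce].
  have c2 : {within A2, continuous h2}.
    apply: (@within_seg _ A2 (g' \o dir) (g \o dir) (fun v => 2 * enorm v - 1)).
    + by move=> v [/= v1 _]; apply/gg'/dirS.
    + exact: t01.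
    + by apply: within_comp cg' => // v [/= v1 _]; exact: dirS.
    + by apply: within_comp cg => // v [/= v1 _]; exact: dirS.
    + apply: continuous_subspaceT => v.
      apply: (continuous_atB (f := fun v => 2 * enorm v) (g := cst 1)); last exact: cst_continuous.
      by apply: (continuous_atM (f := cst 2)); [exact: cst_continuous|exact: ce].
  apply: subspace_eq_continuous c2 => v; rewrite inE => Av.
  by rewrite /from_subspace hA2.
- move=> _ [v /ballE v1 <-]; rewrite /h; case: ifPn => [v2|].
    by apply: hB; exists (2 *: v) => //; exact: h1A.
  rewrite -ltNge => v2; apply: segB; first by apply: dirS; exact: ltW.
  by apply: t01; split=> //; exact: ltW.
- move=> u /sphE u1.
  have Au : A2 u by rewrite /A2 /= u1; split=> //; lra.
  by rewrite hA2// /h2 /dir u1 invr1 scale1r (_ : 2 * 1 - 1 = 1) ?seg1//; field.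
Qed.

End gluing.

Section approximation.
Context {R : realType} {E : topologicalType} (D : E -> E -> R).
Hypotheses (mD : is_metric D) (tD : metric_induces_topology D).
Variables (SS : set (set E)) (N : nat).
Hypothesis eLC : equi_LC R (N%:Z - 1) SS.

(** The radius is taken at the point e of the thickening, not at the point of S;
    for a modulus b, which is 1-Lipschitz, this makes the graph of the
    thickening of a lower semi-continuous map open. *)
Definition thickening (b : E -> R) (S : set E) : set E :=
  [set e | exists2 s, S s & D e s < b e].

Lemma ball_open_graph (T : topologicalType) (f : T -> E) (g : E -> R) x e :
  modulus D SS g -> continuous_at x f -> set_ball D (f x) (g (f x)) e ->
  \forall e' \near e & y \near x, set_ball D (f y) (g (f y)) e'.
Proof.
move=> [_ gL _] /(dist_continuousP tD) cf; rewrite /set_ball /= -subr_gt0.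
set h := _ - _ => h0; have h30 : 0 < h / 3 by rewrite divr_gt0.
exists ([set e' | D e e' < h / 3], [set y | D (f x) (f y) < h / 3]).
  by split; [exact: near_dist|exact: cf].
move=> [e' y] /= [ee' xy].
have := dist_triangle mD (f x) (f y) e'; have := dist_triangle mD e (f x) e'.
have := gL (f x) (f y); rewrite (dist_sym mD (f y) (f x)).
by move: ee' xy; rewrite /h; lra.
Qed.

(** Approximations of f in S are selections of the map that sends a point z of
    the sphere to the part of S near f z. For radii given by iterating
    [extension_modulus], these sets form a chain to which [chain_selection]
    applies; the sphere of dimension k < N lies in a space of dimension
    k + 1, so chains of length k + 1 suffice. *)
Lemma approximation (g : E -> R) : modulus D SS g ->
  exists2 b, modulus D SS b & forall S k (f : 'rV[R]_k.+1 -> E), SS S -> (k < N)%N ->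
    {within unit_sphere R k, continuous f} ->
    f @` unit_sphere R k `<=` thickening b S ->
    exists f' : 'rV[R]_k.+1 -> E, [/\ {within unit_sphere R k, continuous f'},
      f' @` unit_sphere R k `<=` S &
      forall u, unit_sphere R k u -> D (f u) (f' u) < g (f u)].
Proof.
move=> gg.
have /choice[st stP] : forall h : E -> R, exists r, modulus D SS h ->
    [/\ modulus D SS r, forall e, r e <= h e & forall e S k, SS S -> (k < N)%N ->
    sphere_ext R k (set_ball D e (r e) `&` S) (set_ball D e (h e) `&` S)].
  move=> h; have [gh|ngh] := pselect (modulus D SS h); last by exists h.
  have [r [gr rh rP]] := extension_modulus mD tD eLC gh; exists r => _; split=> // e S k SSS kN.
  by apply: rP => //; lia.
pose gam := fix gam i := if i is i'.+1 then st (gam i') else g.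
have gamP i : modulus D SS (gam i).
  by elim: i => [//|i IHi]; have [] := stP _ IHi.
have gam_le i j e : (i <= j)%N -> gam j e <= gam i e.
  elim: j => [|j IHj]; first by rewrite leqn0 => /eqP ->.
  rewrite leq_eqVlt => /orP[/eqP -> //|/IHj]; apply: le_trans.
  by have [_ + _] := stP _ (gamP j); exact.
exists (gam N) => // S k f SSS kN cf fS.
pose Z := subspace (unit_sphere R k).
(* the points outside the sphere are isolated in Z and get the same singleton
   at all stages *)
pose P (j : nat) (z : Z) : set E := if z \in unit_sphere R k
  then set_ball D (f z) (gam (k.+1 - j)%N (f z)) `&` S else [set f 0].
have := @chain_selection R Z E k.+1 _ _ _ P.
case.
- exact: subspace_hausdorff (@norm_hausdorff _ _).
- exact: compact_subspace_paracompact (@sphere_compact R k).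
- exact: ostrand_compact (@sphere_compact R k).
- move=> z; rewrite /P; case: ifPn => [|_]; last by exists (f 0).
  rewrite inE => Sz; have [s Ss fs] := fS (f z) (ex_intro2 _ _ z Sz erefl).
  exists s; split=> //; rewrite subn0.
  exact: lt_le_trans fs (gam_le k.+1 N (f z) kN).
- move=> j z jk; rewrite /P; case: ifPn => [Sz|_]; last exact: sphere_ext1.
  rewrite subSS subSn//; have [_ _ H] := stP _ (gamP (k - j)%N).
  by apply: H => //; exact: leq_ltn_trans kN.
- move=> j z K cK; rewrite /P; case: ifPn => [|Sz].
    rewrite inE => Sz KP.
    have K1 : \forall y \near z, K `<=` set_ball D (f y) (gam (k.+1 - j)%N (f y)).
      apply: open_graph_llc cK _ => [e|e /KP[//]].
      exact: ball_open_graph (cf z).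
    have SZ : \forall y \near z, unit_sphere R k y.
      by apply: open_nbhs_nbhs; split=> //; exact: open_subspaceT.
    apply: filterS2 K1 SZ => y Ky Sy; rewrite mem_set// => e Ke.
    by split; [exact: Ky|have [] := KP e Ke].
  move=> Kf; have : \forall y \near z, y = z.
    apply: open_nbhs_nbhs; split=> //; apply: open_subspace1out.
    by move=> Su; case/negP: Sz; rewrite inE.
  by apply: filterS => y ->; rewrite (negbTE Sz).
move=> f' [cf' f'P]; exists f'; split.
- exact: cf'.
- by move=> _ [u Su <-]; have := f'P u; rewrite /P mem_set// => -[].
- by move=> u Su; have := f'P u; rewrite /P mem_set// subnn => -[].
Qed.

End approximation.

(** * Selections in metric spaces with segments *)

Lemma half_power_lt (R : realType) (e : R) : 0 < e -> exists j, 2^-1 ^+ j < e.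
Proof.
move=> e0; exists (Num.trunc e^-1).+1.
rewrite exprVn -[ltRHS]invrK ltf_pV2 ?posrE ?invr_gt0 ?exprn_gt0//.
apply: lt_trans (truncnS_gt _) _; rewrite -natrX ltr_nat.
exact: ltn_expl.
Qed.

Section metric_selection.
Context {R : realType} {E : topologicalType} (D : E -> E -> R).
Variable seg : E -> E -> R -> E.
Hypotheses (mD : is_metric D) (tD : metric_induces_topology D).
Hypothesis segD : segments D seg.
Variables (SS : set (set E)) (N : nat).
Hypothesis eLC : equi_LC R (N%:Z - 1) SS.
Hypothesis cSS : forall S, SS S -> C_space R (N%:Z - 1) S.
Local Notation modulus := (modulus D SS).
Local Notation thickening := (thickening D).

Lemma subset_thickening b S : modulus b -> SS S -> S `<=` thickening b S.
Proof.
by move=> [_ _ bp] SSS s Ss; exists s => //; rewrite distxx//; exact: bp Ss.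
Qed.

Lemma thickeningS b b' S : (forall e, b e <= b' e) -> thickening b S `<=` thickening b' S.
Proof. by move=> bb' e [s Ss es]; exists s => //; exact: lt_le_trans (bb' e). Qed.

(** All points of the segment are within b x / 2 of s and of x, and b exceeds
    b x / 2 there. *)
Lemma segment_thickening b S x s t : modulus b -> S s -> D x s < b x / 2 ->
  0 <= t <= 1 -> thickening b S (seg s x t).
Proof.
have [_ _ segb _] := segD.
move=> [b01 bL bp] Ss xs t01; have bx := b01 x.
have Dxs := dist_ge0 mD x s.
have h1 : D s (seg s x t) < b x / 2.
  by apply: segb => //; rewrite ?(distxx mD) 1?(dist_sym mD)//; lra.
have h2 : D x (seg s x t) < b x / 2.
  by apply: segb => //; rewrite ?(distxx mD)//; lra.
exists s => //; rewrite (dist_sym mD).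
by have := bL x (seg s x t); lra.
Qed.

(** Approximate the sphere in S, fill the approximation in S, and insert the
    segments. *)
Lemma thickening_extension b : modulus b -> exists2 b', modulus b' &
  forall S k, SS S -> (k < N)%N -> sphere_ext R k (thickening b' S) (thickening b S).
Proof.
move=> gb; have [b01 bL bp] := gb.
have gb2 : modulus (fun e => 2^-1 * b e).
  by apply: modulusM => //; lra.
have [b' gb' b'P] := approximation mD tD eLC gb2.
exists b' => // S k SSS kN g cg gA.
have [g' [cg' g'S gg']] := b'P S k g SSS kN cg gA.
have [_ /(_ k _ g' cg' g'S)[|h' [ch' h'S h'g]]] := cSS SSS; first by lia.
have gg2 u : unit_sphere R k u -> D (g u) (g' u) < b (g u) / 2.
  by move=> /gg'; rewrite mulrC.
apply: (ball_glue tD segD cg cg' ch') => //.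
- exact: subset_trans h'S (subset_thickening gb SSS).
- by move=> u /gg2; rewrite (dist_sym mD); have := b01 (g u); lra.
- by move=> u t Su t01; apply: segment_thickening => //; [apply: g'S; exists u|exact: gg2].
Qed.

(** The same inside balls. It matters that r' does not depend on b: the distance
    between successive approximate selections is controlled by r', whereas the
    quality b of the next approximation is not known beforehand. Spheres in
    the ball of radius rs e / 2 have approximations in the ball of radius rs e,
    where they can be filled within r e. *)
Lemma local_thickening_extension (r : E -> R) : modulus r -> exists2 r', modulus r' &
  forall b, modulus b -> exists2 b', modulus b' &
    forall e S k, SS S -> (k < N)%N ->
      sphere_ext R k (thickening b' S `&` set_ball D e (r' e))
                     (thickening b S `&` set_ball D e (r e)).
Proof.
have [_ _ segb _] := segD.
move=> gr; have [r01 rL rp] := gr.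
have [rs [grs rsr rsP]] := extension_modulus mD tD eLC gr; have [rs01 rsL rsp] := grs.
exists (fun e => 2^-1 * rs e); first by apply: modulusM => //; lra.
move=> b gb; have [b01 bL bp] := gb.
have gc : modulus (fun e => Num.min (2^-1 * b e) (4^-1 * rs e)).
  by apply: modulus_min; apply: modulusM => //; lra.
have [b' gb' b'P] := approximation mD tD eLC gc.
exists b' => // e S k SSS kN g cg gA.
have [|g' [cg' g'S gg']] := b'P S k g SSS kN cg; first by move=> x /gA[].
have gg2 u : unit_sphere R k u -> D (g u) (g' u) < b (g u) / 2.
  by move=> /gg'; rewrite lt_min mulrC => /andP[].
have gg4 u : unit_sphere R k u -> D (g u) (g' u) < 4^-1 * rs (g u).
  by move=> /gg'; rewrite lt_min => /andP[].
have eg u : unit_sphere R k u -> D e (g u) < 2^-1 * rs e.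
  by move=> Su; have [_] := gA (g u) (ex_intro2 _ _ u Su erefl).
have eg' u : unit_sphere R k u -> D e (g' u) < rs e.
  move=> Su; have := dist_triangle mD (g u) e (g' u); have := rsL (g u) e.
  by rewrite (dist_sym mD (g u) e); have := gg4 u Su; have := eg u Su;
  by have := rs01 e; lra.
have kn : (k%:Z <= N%:Z - 1)%R by lia.
have [|h' [ch' h'S h'g]] := rsP e S k SSS kn g' cg'.
  by move=> _ [u Su <-]; split; [exact: eg'|apply: g'S; exists u].
apply: (ball_glue tD segD cg cg' ch') => //.
- by move=> x /h'S[xe Sx]; split=> //; exact: subset_thickening Sx.
- by move=> u /gg2; rewrite (dist_sym mD); have := b01 (g u); lra.
- move=> u t Su t01; split.
    by apply: segment_thickening => //; [apply: g'S; exists u|exact: gg2].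
  rewrite /set_ball /=; apply: segb => //; first by have := r01 e; lra.
    exact: lt_le_trans (eg' u Su) (rsr e).
  by have := eg u Su; have := rsr e; have := rs01 e; lra.
Qed.

Section selections.
Context {X : topologicalType}.
Hypotheses (hX : hausdorff_space X) (pX : paracompact_space X).
Hypothesis oX : ostrand N X.
Variable Phi : X -> set E.
Hypothesis PhiS : forall x, SS (Phi x).
Hypothesis lscPhi : lower_semicontinuous_map Phi.

Lemma thickening_open_graph b x e : modulus b -> thickening b (Phi x) e ->
  \forall e' \near e & y \near x, thickening b (Phi y) e'.
Proof.
move=> [_ bL _] [s Ps]; rewrite -subr_gt0.
set h := _ - _ => h0; have h40 : 0 < h / 4 by rewrite divr_gt0.
have oB : open (set_ball D s (h / 4))°  by exact: open_interior.
have sB : (set_ball D s (h / 4))° s by exact: near_dist.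
exists ([set e' | D e e' < h / 4],
        [set y | Phi y `&` (set_ball D s (h / 4))° !=set0]).
  split; first exact: near_dist.
  by apply: open_nbhs_nbhs; split; [exact: lscPhi|exists s].
move=> [e' y] /= [ee' [s' [Ps' /interior_subset ss']]]; exists s' => //.
have := dist_triangle mD e e' s'; have := dist_triangle mD s e s'.
have := bL e e'; rewrite (dist_sym mD e' e).
by move: (h0) ee' ss'; rewrite /set_ball /= /h; lra.
Qed.

(** Iterating [thickening_extension] N times backwards from b gives a chain. *)
Lemma first_selection b : modulus b ->
  exists f : X -> E, continuous f /\ forall x, thickening b (Phi x) (f x).
Proof.
move=> gb.
have /choice[st stP] : forall b : E -> R, exists b', modulus b ->
    modulus b' /\ forall S k, SS S -> (k < N)%N ->
      sphere_ext R k (thickening b' S) (thickening b S).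
  move=> c; have [gc|ngc] := pselect (modulus c); last by exists c.
  by have [c' gc' c'P] := thickening_extension gc; exists c'.
pose bb := fix bb i := if i is i'.+1 then st (bb i') else b.
have gbb i : modulus (bb i) by elim: i => [//|i IHi]; have [] := stP _ IHi.
have [|||f [cf fP]] := @chain_selection R X E N hX pX oX
    (fun k x => thickening (bb (N - k)%N) (Phi x)).
- move=> x; have [[s Ps] _] := cSS (PhiS x); exists s.
  exact: subset_thickening (PhiS x) _ Ps.
- move=> k x kN; rewrite -(subnSK kN) /=.
  by have [_] := stP _ (gbb (N - k.+1)%N); apply.
- move=> k x K cK; apply: open_graph_llc cK => e; exact: thickening_open_graph.
- by exists f; split=> // x; have := fP x; rewrite subnn.
Qed.

(** The chain consists of thickenings of the values intersected with balls around
    f. The radii rr are chosen first, and their last member is the quality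
    required of f; the thickenings bb are chosen backwards from b. *)
Lemma next_selection (eps : R) : 0 < eps -> exists2 a, modulus a &
  forall b (f : X -> E), modulus b -> continuous f ->
    (forall x, thickening a (Phi x) (f x)) ->
  exists f' : X -> E, [/\ continuous f', forall x, thickening b (Phi x) (f' x) &
    forall x, D (f x) (f' x) < eps].
Proof.
move=> eps0.
have /choice[sr srP] : forall r : E -> R, exists r', modulus r -> modulus r' /\
    forall b, modulus b -> exists2 b', modulus b' &
    forall e S k, SS S -> (k < N)%N ->
      sphere_ext R k (thickening b' S `&` set_ball D e (r' e))
                     (thickening b S `&` set_ball D e (r e)).
  move=> r; have [gr|ngr] := pselect (modulus r); last by exists r.
  by have [r' gr' r'P] := local_thickening_extension gr; exists r'.
pose eps1 := Num.min eps 1.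
have eps1P : 0 < eps1 <= 1 by rewrite lt_min eps0 ltr01 ge_min lexx orbT.
pose rr := fix rr i := if i is i'.+1 then sr (rr i') else (fun _ : E => eps1).
have grr i : modulus (rr i).
  by elim: i => [|i IHi]; [exact: modulus_cst|have [] := srP _ IHi].
exists (rr N) => // b f gb cf fP.
have /choice[sb sbP] : forall ib : nat * (E -> R), exists b', modulus ib.2 ->
    modulus b' /\ forall e S k, SS S -> (k < N)%N ->
      sphere_ext R k (thickening b' S `&` set_ball D e (rr ib.1.+1 e))
                     (thickening ib.2 S `&` set_ball D e (rr ib.1 e)).
  move=> [i c] /=; have [gc|ngc] := pselect (modulus c); last by exists c.
  by have [_ /(_ c gc)[c' gc' c'P]] := srP _ (grr i); exists c'.
pose bb := fix bb i := if i is i'.+1 then sb (i', bb i') else b.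
have gbb i : modulus (bb i) by elim: i => [//|i IHi]; have [] := sbP (i, _) IHi.
have [|||f' [cf' f'P]] := @chain_selection R X E N hX pX oX
    (fun k x => thickening (bb (N - k)%N) (Phi x) `&` set_ball D (f x) (rr (N - k)%N (f x))).
- move=> x; have [s Ps fs] := fP x; exists s; rewrite subn0; split=> //.
  exact: subset_thickening (PhiS x) _ Ps.
- move=> k x kN; rewrite -(subnSK kN) /=.
  have [_ H] := sbP ((N - k.+1)%N, bb (N - k.+1)%N) (gbb _); exact: H.
- move=> k x K cK; apply: open_graph_llc cK => e [te be].
  have te' := thickening_open_graph (gbb _) te.
  have be' := ball_open_graph mD tD (grr _) (cf x) be.
  by apply: filterS2 te' be' => -[e' y] /=.
- exists f'; split=> // x; have := f'P x; rewrite subnn => -[//].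
  by move=> _; rewrite /set_ball /= lt_min => /andP[].
Qed.

Hypothesis complete_SS : forall S, SS S -> forall u : nat -> E,
  (forall i, S (u i)) -> metric_cauchy D u ->
  exists2 s, S s & forall eps, 0 < eps ->
    exists j, forall i, (j <= i)%N -> D (u i) s < eps.

(** The approximate selections F j satisfy D (F j x) (F j.+1 x) < 2^-j, and F j x
    is within 2^-j of a point s (j, x) of Phi x. The sequence s (-, x) is
    Cauchy in Phi x; its limit is the uniform limit of the F j. *)
Theorem metric_selection : exists f : X -> E, continuous f /\ forall x, Phi x (f x).
Proof.
pose w j : R := 2^-1 ^+ j.
have w0 j : 0 < w j by rewrite exprn_gt0// invr_gt0.
have wS j : w j.+1 = w j / 2 by rewrite /w exprSr.
have w1 j : w j <= 1 by rewrite exprn_ile1// ?invr_ge0// invf_le1// ler1n.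
have /choice[a0 a0P] : forall j : nat, exists a, modulus a /\
  forall b (f : X -> E), modulus b -> continuous f ->
    (forall x, thickening a (Phi x) (f x)) ->
  exists f' : X -> E, [/\ continuous f', forall x, thickening b (Phi x) (f' x) &
    forall x, D (f x) (f' x) < w j].
  by move=> j; have [a ga aP] := next_selection (w0 j); exists a.
pose a j e := Num.min (a0 j e) (w j).
have ga j : modulus (a j).
  apply: modulus_min; first by have [] := a0P j.
  by apply: (modulus_cst mD); rewrite w0 w1.
have /choice[next nextP] : forall jf : nat * (X -> E), exists f' : X -> E,
    continuous jf.2 -> (forall x, thickening (a jf.1) (Phi x) (jf.2 x)) ->
    [/\ continuous f', forall x, thickening (a jf.1.+1) (Phi x) (f' x) &
    forall x, D (jf.2 x) (f' x) < w jf.1].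
  move=> [j f] /=.
  have [[cf fP]|nf] := pselect (continuous f /\ forall x, thickening (a j) (Phi x) (f x));
    last by exists f => cf fP; exfalso; apply: nf.
  have [_ H] := a0P j; have [|f' f'P] := H (a j.+1) f (ga _) cf; last by exists f'.
  by move=> x; apply: thickeningS (fP x) => e; rewrite ge_min lexx.
have [f0 [cf0 f0P]] := first_selection (ga 0%N).
pose F := fix F j := if j is j'.+1 then next (j', F j') else f0.
have FP j : continuous (F j) /\ forall x, thickening (a j) (Phi x) (F j x).
  by elim: j => [//|j [cF IHj]]; have [] := nextP (j, F j) cF IHj.
have FD j x : D (F j x) (F j.+1 x) < w j.
  by have [cF FT] := FP j; have [_ _] := nextP (j, F j) cF FT; apply.
have FDm j m x : D (F j x) (F (j + m)%N x) <= 2 * w j - 2 * w (j + m)%N.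
  elim: m => [|m IHm]; first by rewrite addn0 (distxx mD) subrr.
  have := dist_triangle mD (F (j + m)%N x) (F j x) (F (j + m.+1)%N x).
  by rewrite addnS; have := FD (j + m)%N x; rewrite wS; lra.
have /choice[s sP] : forall jx : nat * X, exists s, Phi jx.2 s /\
    D (F jx.1 jx.2) s < w jx.1.
  move=> [j x]; have [_ /(_ x)[s Ps]] := FP j; rewrite lt_min => /andP[_ Ds].
  by exists s.
have sD i j x : (i <= j)%N -> D (s (i, x)) (s (j, x)) < 4 * w i.
  move=> ij; have [_ /= si] := sP (i, x); have [_ /= sj] := sP (j, x).
  have := FDm i (j - i)%N x; rewrite subnKC//.
  have := dist_triangle mD (F i x) (s (i, x)) (s (j, x)).
  have := dist_triangle mD (F j x) (F i x) (s (j, x)).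
  by rewrite (dist_sym mD (s (i, x)) (F i x)); have := w0 j; have := w0 i; lra.
have /choice[f fP] : forall x, exists y, Phi x y /\ forall j, D (F j x) y <= 3 * w j.
  move=> x; have [||y Py yP] := complete_SS (PhiS x) (u := fun j => s (j, x)).
  - by move=> j; have [] := sP (j, x).
  - move=> e e0; have [M Me] := half_power_lt (divr_gt0 e0 (ltr0n R 8)).
    exists M => i j Mi Mj; have := sD M i x Mi; have := sD M j x Mj.
    have := dist_triangle mD (s (M, x)) (s (i, x)) (s (j, x)).
    rewrite (dist_sym mD (s (i, x)) (s (M, x))).
    by move: Me; rewrite -/(w M); lra.
  - exists y; split=> // j; apply/ler_addgt0Pr => e e0.
    have [M MP] := yP e e0; have := MP (j + M)%N (leq_addl _ _).
    have [_ /= sj] := sP ((j + M)%N, x).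
    have := FDm j M x.
    have := dist_triangle mD (F (j + M)%N x) (F j x) y.
    have := dist_triangle mD (s ((j + M)%N, x)) (F (j + M)%N x) y.
    have : w (j + M)%N <= w j.
      by rewrite /w exprD ler_piMr// ?ltW// -/(w M).
    by have := w0 (j + M)%N; lra.
exists f; split; last by move=> x; have [] := fP x.
move=> x; apply/(dist_continuousP tD) => e e0.
have [M Me] := half_power_lt (divr_gt0 e0 (ltr0n R 12)).
have [cF _] := FP M; have /(dist_continuousP tD)/(_ _ (w0 M)) := cF x.
apply: filterS => y Fxy; have [_ /(_ M) fx] := fP x; have [_ /(_ M) fy] := fP y.
have := dist_triangle mD (F M x) (f x) (f y).
have := dist_triangle mD (F M y) (F M x) (f y).
rewrite (dist_sym mD (f x) (F M x)).
by move: Me; rewrite -/(w M); have := w0 M; lra.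
Qed.

End selections.
End metric_selection.

(** * Embedding into a space of functions *)

Section function_space.
Context {R : realType} {Y : topologicalType}.
Local Notation E := (arrow_uniform_type Y R).
Implicit Types (e a b c : E).

(** Truncation at 1 gives a metric although functions may be unbounded; 0 is
    included for the case that Y is empty. *)
Definition truncated_distances a b : set R :=
  [set r | r = 0 \/ exists y, r = Num.min 1 `|a y - b y|].

Definition sup_dist a b : R := sup (truncated_distances a b).

Lemma has_sup_truncated_distances a b : has_sup (truncated_distances a b).
Proof.
split; first by exists 0; left.
by exists 1 => _ [->|[y ->]]; rewrite ?ler01// ge_min lexx.
Qed.

Lemma sup_dist_ge0 a b : 0 <= sup_dist a b.
Proof. by apply: sup_upper_bound; [exact: has_sup_truncated_distances|left]. Qed.

Lemma sup_dist_ub a b y : Num.min 1 `|a y - b y| <= sup_dist a b.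
Proof. by apply: sup_upper_bound; [exact: has_sup_truncated_distances|right; exists y]. Qed.

Lemma sup_dist_le a b r : 0 <= r ->
  (forall y, Num.min 1 `|a y - b y| <= r) -> sup_dist a b <= r.
Proof.
by move=> r0 abr; apply: sup_le_ub => [|_ [->//|[y ->]]]; [exists 0; left|].
Qed.

Lemma sup_dist_le_norm a b r : 0 <= r ->
  (forall y, `|a y - b y| <= r) -> sup_dist a b <= r.
Proof. by move=> r0 abr; apply: sup_dist_le => // y; rewrite ge_min abr orbT. Qed.

Lemma sup_dist_le1 a b : sup_dist a b <= 1.
Proof. by apply: sup_dist_le => // y; rewrite ge_min lexx. Qed.

Lemma norm_le_sup_dist a b y : sup_dist a b < 1 -> `|a y - b y| <= sup_dist a b.
Proof.
move=> ab1; have := sup_dist_ub a b y; rewrite ge_min => /orP[|//].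
by move=> /le_lt_trans/(_ ab1); rewrite ltxx.
Qed.

Lemma sup_dist_metric : is_metric sup_dist.
Proof.
have sym a b : sup_dist a b = sup_dist b a.
  by rewrite /sup_dist /truncated_distances; congr (sup _); apply/seteqP; split=> r;
    (case=> [->|[y ->]]; [left|right; exists y; rewrite distrC]).
split=> //; first exact: sup_dist_ge0.
  move=> a b; split=> [ab0|->].
    apply/funext => y; have := @norm_le_sup_dist a b y; rewrite ab0 => /(_ ltr01).
    by rewrite normr_le0 subr_eq0 => /eqP.
  apply/eqP; rewrite eq_le sup_dist_ge0 andbT.
  by apply: sup_dist_le_norm => // y; rewrite subrr normr0.
move=> a b c; apply: sup_dist_le => [|y]; first by rewrite addr_ge0 ?sup_dist_ge0.
apply: le_trans (lerD (sup_dist_ub a b y) (sup_dist_ub b c y)).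
have := ler_distD (b y) (a y) (c y).
have := normr_ge0 (a y - b y); have := normr_ge0 (b y - c y).
rewrite ge_min; case: (leP 1 `|a y - b y|) => h1; case: (leP 1 `|b y - c y|) => h2;
  by move=> *; apply/orP; lra.
Qed.

Lemma sup_dist_topology : metric_induces_topology sup_dist.
Proof.
move=> e A; split=> [/nbhs_ballP[r /= r0 rA]|[r r0 rA]].
  exists (Num.min r 1); first by rewrite lt_min r0 ltr01.
  move=> e' /=; rewrite lt_min => /andP[er e1]; apply: rA => y.
  by rewrite /ball /=; apply: le_lt_trans er; exact: norm_le_sup_dist.
apply/nbhs_ballP; exists (r / 2) => /=; first by rewrite divr_gt0.
move=> e' ee'; apply: rA => /=; apply: (@le_lt_trans _ _ (r / 2)); last by lra.
by apply: sup_dist_le_norm => [|y]; [lra|apply/ltW/ee'].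
Qed.

Definition affine_seg a b (t : R) : E := fun y => (1 - t) * a y + t * b y.

Lemma affine_segments : segments sup_dist affine_seg.
Proof.
split.
- by move=> a b; apply/funext => y; rewrite /affine_seg; ring.
- by move=> a b; apply/funext => y; rewrite /affine_seg; ring.
- move=> a b c t r t01 r1 ca cb.
  apply: (@le_lt_trans _ _ (Num.max (sup_dist c a) (sup_dist c b))); last first.
    by rewrite gt_max ca cb.
  apply: sup_dist_le_norm => [|y]; first by rewrite le_max sup_dist_ge0.
  have h1 := @norm_le_sup_dist c a y (lt_le_trans ca r1).
  have h2 := @norm_le_sup_dist c b y (lt_le_trans cb r1).
  set m := Num.max _ _.
  have m1 : `|c y - a y| <= m by rewrite le_max h1.
  have m2 : `|c y - b y| <= m by rewrite le_max h2 orbT.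
  have -> : c y - affine_seg a b t y = (1 - t) * (c y - a y) + t * (c y - b y).
    by rewrite /affine_seg; ring.
  apply: le_trans (ler_normD _ _) _.
  have t0 : 0 <= t by lra.
  have t1 : 0 <= 1 - t by lra.
  rewrite !normrM (ger0_norm t0) (ger0_norm t1).
  by nra.
- move=> a b a' b' t t' ab t01 t01'.
  set r := _ + _ + _.
  have [r1|r1] := leP 1 r; first exact: le_trans (sup_dist_le1 _ _) r1.
  have := normr_ge0 (t - t') => tt'; have := sup_dist_ge0 a a' => Da.
  have := sup_dist_ge0 b b' => Db.
  apply: sup_dist_le_norm => [|y]; first by rewrite /r; lra.
  have h1 : `|a y - a' y| <= sup_dist a a' by apply: norm_le_sup_dist; rewrite /r in r1; lra.
  have h2 : `|b y - b' y| <= sup_dist b b' by apply: norm_le_sup_dist; rewrite /r in r1; lra.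
  have h3 := @norm_le_sup_dist a b y ab.
  have -> : affine_seg a b t y - affine_seg a' b' t' y =
      (1 - t') * (a y - a' y) + t' * (b y - b' y) - (t - t') * (a y - b y).
    by rewrite /affine_seg; ring.
  apply: le_trans (ler_normB _ _) _.
  apply: le_trans (lerD (ler_normD _ _) (lexx _)) _.
  have t0 : 0 <= t' by lra.
  have t1 : 0 <= 1 - t' by lra.
  rewrite !normrM (ger0_norm t0) (ger0_norm t1).
  have := normr_ge0 (a y - b y).
  have := normr_ge0 (a y - a' y); have := normr_ge0 (b y - b' y).
  by rewrite /r; nra.
Qed.

Variable d : Y -> Y -> R.
Hypotheses (md : is_metric d) (td : metric_induces_topology d).

(** Kuratowski's embedding, for the metric truncated at 1. *)
Definition kuratowski (y : Y) : E := fun z => Num.min 1 (d y z).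

Lemma kuratowski_dist y y' : sup_dist (kuratowski y) (kuratowski y') = Num.min 1 (d y y').
Proof.
apply/eqP; rewrite eq_le; apply/andP; split.
  apply: sup_dist_le_norm => [|z]; first by rewrite le_min ler01 dist_ge0.
  have := dist_triangle md y' y z; have := dist_triangle md y y' z.
  rewrite (dist_sym md y' y) /kuratowski.
  have := dist_ge0 md y z; have := dist_ge0 md y' z; have := dist_ge0 md y y'.
  rewrite le_min; case: (leP 1 (d y z)) => h1; case: (leP 1 (d y' z)) => h2 *;
    by apply/andP; split; rewrite ler_norml; lra.
have := sup_dist_ub (kuratowski y) (kuratowski y') y'.
rewrite /kuratowski (distxx md) (min_r ler01) subr0.
rewrite ger0_norm; last by rewrite le_min ler01 dist_ge0.
by rewrite minA minxx.
Qed.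

Lemma kuratowski_dist_lt y y' r : r <= 1 ->
  (sup_dist (kuratowski y) (kuratowski y') < r) = (d y y' < r).
Proof. by move=> r1; rewrite kuratowski_dist gt_min ltNge r1. Qed.

Lemma kuratowski_inj : injective kuratowski.
Proof.
move=> y y' yy'; apply: contrapT => ny.
have [_ dE _ _] := md; have d0 : 0 < d y y'.
  by rewrite lt_neqAle dist_ge0// andbT eq_sym; apply/eqP => /dE.
have : sup_dist (kuratowski y) (kuratowski y') = 0.
  by rewrite yy'; have [_ /(_ (kuratowski y') (kuratowski y'))[_ ->]] := sup_dist_metric.
by rewrite kuratowski_dist => /eqP; rewrite eq_le ge_min !leNgt ltr01 d0.
Qed.

Lemma kuratowski_continuous : continuous kuratowski.
Proof.
move=> y; apply/(dist_continuousP sup_dist_topology) => r r0.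
have r10 : 0 < Num.min r 1 by rewrite lt_min r0 ltr01.
apply: filterS (near_dist td y r10) => y'; rewrite lt_min => /andP[yr y1].
by rewrite kuratowski_dist gt_min yr orbT.
Qed.

(** The inverse of the isometric embedding is continuous on the image; j is any
    extension of it to the whole space. *)
Lemma kuratowski_retract_continuous (T : topologicalType) (A : set T)
    (j : E -> Y) (g : T -> E) :
  (forall y, j (kuratowski y) = y) -> (forall x, A x -> range kuratowski (g x)) ->
  {within A, continuous g} -> {within A, continuous j \o g}.
Proof.
move=> jK gk /(dist_within_continuousP sup_dist_topology) cg.
apply/(dist_within_continuousP td) => x Ax r r0.
have r10 : 0 < Num.min r 1 by rewrite lt_min r0 ltr01.
apply: filterS (cg x Ax _ r10) => y gxy Ay.
have /= := gxy Ay; have [x' _ <-] := gk x Ax; have [y' _ <-] := gk y Ay.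
rewrite !jK kuratowski_dist_lt ?ge_min ?lexx ?orbT//.
by rewrite lt_min => /andP[].
Qed.

Lemma kuratowski_sphere_ext (j : E -> Y) k (A B : set Y) :
  (forall y, j (kuratowski y) = y) ->
  sphere_ext R k A B -> sphere_ext R k (kuratowski @` A) (kuratowski @` B).
Proof.
move=> jK AB g cg gA.
have [||h [ch hB hg]] := AB (j \o g).
- apply: kuratowski_retract_continuous => // u Su.
  by have [|y _ <-] := gA (g u); [exists u|exists y].
- move=> _ [u Su <-]; have [|y Ay /= <-] := gA (g u); first by exists u.
  by rewrite jK.
exists (kuratowski \o h); split.
- have ck : {within setT, continuous kuratowski}.
    by apply: continuous_subspaceT; exact: kuratowski_continuous.
  by apply: within_comp ck.
- by move=> _ [u Bu <-]; exists (h u) => //; apply: hB; exists u.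
- move=> u Su; rewrite /= hg//=; have [|y _ /= <-] := gA (g u); first by exists u.
  by rewrite jK.
Qed.

End function_space.

Theorem theorem1p1 (R : realType) (n : int) (X Y : topologicalType)
    (SS : set (set Y)) (Phi : X -> set Y) :
  -1 <= n ->
  hausdorff_space X -> paracompact_space X -> covering_dim_le X (n + 1) ->
  completely_metrizable R Y ->
  SS `<=` nonempty_closed Y ->
  equi_LC R n SS ->
  (forall S, SS S -> C_space R n S) ->
  (forall x, SS (Phi x)) ->
  lower_semicontinuous_map Phi ->
  exists f : X -> Y, continuous_selection Phi f.
Proof.
move=> n1 hX pX dX [d [md td cd]] SSc eLC cSS PhiS lsc.
have [N nE] : exists N : nat, n = (N%:Z - 1)%R :> int.
  by exists (absz (n + 1)%R); rewrite gez0_abs ?addrK//; lia.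
move: dX eLC cSS; rewrite nE subrK => dX eLC cSS {n n1 nE}.
have [[y0 _]|nY] := pselect (exists y : Y, True); last first.
  have F (x : X) : False by have [[y _] _] := SSc _ (PhiS x); apply: nY; exists y.
  by exists (fun x => False_rect Y (F x)); split=> x; case: (F x).
pose iota : Y -> arrow_uniform_type Y R := kuratowski d.
have iota_inj : injective iota by exact: kuratowski_inj.
have /choice[j jP] : forall e, exists y, (exists z, iota z = e) -> iota y = e.
  by move=> e; have [[z ze]|ne] := pselect (exists z, iota z = e); [exists z|exists y0].
have jK y : j (iota y) = y by apply: iota_inj; apply: jP; exists y.
(* the hypotheses on the family SS carry over to its image under iota *)
pose SS' := [set iota @` S | S in SS].
have eLC' : equi_LC R (N%:Z - 1) SS'.
  have [ne LC] := eLC; split.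
    by move=> _ [S SSS <-]; have [y Sy] := ne S SSS; exists (iota y), y.
  move=> _ [_ [S SSS <-] [y Sy <-]] U Uy.
  have [||V [Vy VU VP]] := LC y _ (iota @^-1` U); first by exists S.
    exact: kuratowski_continuous Uy.
  have /td[r r0 rV] := Vy.
  have r10 : 0 < Num.min r 1 by rewrite lt_min r0 ltr01.
  exists (U `&` [set e | sup_dist (iota y) e < Num.min r 1]); split.
  - by apply: filterI => //; exact: (near_dist sup_dist_topology).
  - by move=> e [].
  - move=> _ [S' SSS' <-] k kN.
    have := kuratowski_sphere_ext md td jK (VP S' SSS' k kN).
    apply: sphere_extW.
      move=> e [[_ re] [z S'z ze]]; exists z => //; split=> //; apply: rV => /=.
      move: re; rewrite -ze /= kuratowski_dist_lt ?ge_min ?lexx ?orbT//.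
      by rewrite lt_min => /andP[].
    by move=> _ [z [Uz S'z] <-]; split=> //; exists z.
have cSS' S : SS' S -> C_space R (N%:Z - 1) S.
  move=> [S0 SSS0 <-]; have [[y Sy] ext] := cSS S0 SSS0; split.
    by exists (iota y), y.
  by move=> k kN; apply: (kuratowski_sphere_ext md td jK); exact: ext.
have [|||f [cf fP]] := metric_selection sup_dist_metric sup_dist_topology
    affine_segments eLC' cSS' hX pX (ostrand_paracompact R hX pX dX)
    (Phi := fun x => iota @` Phi x).
- by move=> x; exists (Phi x).
- move=> U oU.
  have -> : [set x | (iota @` Phi x) `&` U !=set0] =
            [set x | Phi x `&` iota @^-1` U !=set0].
    apply/seteqP; split=> x.
      by move=> [_ [[y Py <-] Uy]]; exists y.
    by move=> [y [Py Uy]]; exists (iota y); split=> //; exists y.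
  apply: lsc; move/continuousP : (kuratowski_continuous md td); exact.
- move=> _ [S SSS <-] u uS cu.
  have uE i : iota (j (u i)) = u i by have [y _ <-] := uS i; rewrite jK.
  have [|y uy] := cd (j \o u).
    move=> e e0; have e10 : 0 < Num.min e 1 by rewrite lt_min e0 ltr01.
    have [M MP] := cu _ e10; exists M => i k Mi Mk.
    have := MP i k Mi Mk; rewrite -(uE i) -(uE k).
    by rewrite kuratowski_dist_lt ?ge_min ?lexx ?orbT// lt_min => /andP[].
  have Sy : S y.
    have [_ cS] := SSc S SSS.
    have Sj : \forall i \near \oo, S ((j \o u) i).
      by apply: nearW => i /=; have [z Sz <-] := uS i; rewrite jK.
    exact: closed_cvg cS Sj _ uy.
  exists (iota y); first by exists y.
  move=> e e0.
  have /uy : nbhs y [set z | d y z < e] by exact: (near_dist td).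
  move=> [M _ MP]; exists M => i Mi; have := MP i Mi; rewrite /= => dy.
  rewrite (dist_sym sup_dist_metric) -(uE i) kuratowski_dist//.
  by rewrite gt_min dy orbT.
exists (j \o f); split.
  have cjf : {within [set: X], continuous j \o f}.
    apply: (kuratowski_retract_continuous md td jK).
      by move=> x _; have [y _ <-] := fP x; exists y.
    exact: continuous_subspaceT.
  by move=> x; have := cjf x; rewrite /continuous_at nbhs_subspaceT.
by move=> x; have [y Py /= <-] := fP x; rewrite jK.
Qed.
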